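(* Let $A$ be a primitive set with $f(A)>f(\mathcal P(A))+\epsilon_0$. Then $f(A_3)<f(\mathcal P(A_3))$, where $A_3=\{a\in A: a\text{ odd}\}$.
   Context: A set $A$ of integers greater than $1$ is primitive if no element of $A$ divides any other. For a set $B$ of integers $>1$, $f(B)=\sum_{b\in B}1/(b\log b)$, and $\mathcal P(B)$ is the set of primes dividing some element of $B$ (so $f(\mathcal P(B))=\sum_{p\in\mathcal P(B)}1/(p\log p)$). $\gamma$ is Euler's constant. A prime $q$ is a Mertens prime if $e^\gamma\prod_{r<q}(1-1/r)\le1/\log q$ (product over primes $r<q$). The constant $\epsilon_0$ is defined by $\epsilon_0=\sum_{p}\big(\frac{e^\gamma}{p}\prod_{r<p}(1-\frac1r)-\frac{1}{p\log p}\big)$, the sum over odd primes $p$ that are not Mertens primes. *)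

(* Defs.v *)
From mathcomp Require Import all_boot all_order all_algebra.
From mathcomp Require Import all_classical all_reals all_analysis.

Set Implicit Arguments.
Unset Strict Implicit.
Unset Printing Implicit Defensive.

Import Order.TTheory GRing.Theory Num.Theory.
Import numFieldNormedType.Exports.

Local Open Scope classical_set_scope.
Local Open Scope ring_scope.

Definition primitive_set (A : set nat) : Prop :=
  (forall a, A a -> (1 < a)%N) /\
  (forall a b, A a -> A b -> (a %| b)%N -> a = b).

Definition prime_support (B : set nat) : set nat :=
  [set p | prime p /\ exists2 b, B b & (p %| b)%N].

Definition odd_part (A : set nat) : set nat := A `&` [set a | odd a].

(* Valued in the extended reals: the sum over an arbitrary set of integers
   greater than 1 may diverge. *)
Definition erdos_sum (R : realType) (B : set nat) : \bar R :=
  \esum_(b in B) ((b%:R * ln (b%:R : R))^-1)%:E.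

(* [series harmonic n.+1] is 1 + 1/2 + ... + 1/(n+1).  The sequence is
   decreasing and nonnegative, so [limn] is a genuine limit. *)
Definition euler_gamma (R : realType) : R :=
  limn (fun n : nat => series (@harmonic R) n.+1 - ln (n.+1%:R : R)).

Definition mertens_product (R : realType) (q : nat) : R :=
  \prod_(0 <= r < q | prime r) (1 - r%:R^-1).

Definition mertens_prime (R : realType) (q : nat) : Prop :=
  prime q /\
  expR (euler_gamma R) * mertens_product R q <= (ln (q%:R : R))^-1.

(* The terms are positive, precisely because p is not a Mertens prime, so the
   unordered sum [esum] is the value of the series. *)
Definition epsilon0 (R : realType) : \bar R :=
  \esum_(p in [set p : nat | [/\ prime p, odd p & ~ mertens_prime R p]])
    (expR (euler_gamma R) / p%:R * mertens_product R p
     - (p%:R * ln (p%:R : R))^-1)%:E.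

(* Main.v *)
(* The sets {a m : every prime factor of m is at least the largest prime P(a)
   of a}, for a in a primitive set whose elements are all divisible by d, are
   disjoint sets of multiples of d.  Comparing their densities through
   Dirichlet series as s -> 1+ gives
     sum_a 1/a prod_{r < P(a)} (1 - 1/r) <= 1/d.
   A form of Mertens' theorem supplies a constant C <= e^gamma with
   C ln (3 q) prod_{r < q} (1 - 1/r) >= 1 for all odd primes q, so that
   1 / ln a <= C prod_{r < P(a)} (1 - 1/r) for every odd composite a.  Hence the
   odd elements with least prime factor p contribute at most the larger of
   1 / (p ln p) and C/p prod_{r < p} (1 - 1/r), and summing over p gives
   f(A_3) <= f(P(A_3)) + epsilon0.

   The even elements contribute at most f({2}), or f({2, 3}) when
   one of them is a multiple of 3.  So f(A) <= f(P(A)) + epsilon0 unless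
   3 is not in A but divides some odd element of A.  In that case the elements
   with least prime factor 3 contribute at most C/6, which is smaller than
   f({3}) by more than the total surplus at the primes p >= 5: that surplus
   vanishes for p <= 10^4, by computation, and beyond it is bounded by a
   telescoping sum.

   C is exp c where c is the limit of
   sum_{n <= N} Lambda(n) / (n ln n) - ln ln N as N grows.
   Mertens' theorem in the form c = gamma is not needed: c <= gamma suffices. *)
Require Import Defs.
From Stdlib Require Import NArith.
From mathcomp Require Import all_boot all_order all_algebra.
From mathcomp Require Import all_classical all_reals all_analysis.
From mathcomp Require Import finmap ring lra zify.

Set Implicit Arguments.
Unset Strict Implicit.
Unset Printing Implicit Defensive.
Import Order.TTheory GRing.Theory Num.Theory.
Import numFieldNormedType.Exports.
Local Open Scope classical_set_scope.
Local Open Scope ring_scope.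


(** * Bounds on the logarithm *)

Lemma le_from_derive (R : realType) (f df : R -> R) (x : R) : 0 <= x ->
  (forall t, 0 <= t <= x -> is_derive t 1 f (df t)) ->
  (forall t, 0 <= t <= x -> 0 <= df t) -> f 0 <= f x.
Proof.
move=> x0 fd df0.
have [c cx e] : exists2 c, c \in `[0, x]%R & f x - f 0 = df c * (x - 0).
  apply: MVT_segment => // [t|].
    by rewrite in_itv/= => /andP[/ltW a /ltW b]; apply: fd; rewrite a b.
  apply: derivable_within_continuous => t; rewrite in_itv/= => tx.
  by have := fd _ tx; case.
rewrite -subr_ge0 e mulr_ge0//; last by rewrite subr0.
by apply: df0; move: cx; rewrite in_itv.
Qed.

Lemma is_derive_lnD1 (R : realType) (t : R) : 0 <= t ->
  is_derive t 1 (fun t => ln (1 + t)) (1 + t)^-1.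
Proof.
move=> t0; have h : 0 < 1 + t by rewrite ltr_wpDr.
have d1 : is_derive t 1 (fun t : R => 1 + t) 1.
  by rewrite -[X in is_derive _ _ _ X]add0r; apply: is_deriveD.
by rewrite -[X in is_derive _ _ _ X]mulr1; exact: (is_derive1_comp (is_derive1_ln h) d1).
Qed.

Lemma is_derive_lnN1 (R : realType) (t : R) : t < 1 ->
  is_derive t 1 (fun t => ln (1 - t)) (- (1 - t)^-1).
Proof.
move=> t1; have h : 0 < 1 - t by rewrite subr_gt0.
have d1 : is_derive t 1 (fun t : R => 1 - t) (-1).
  by rewrite -[X in is_derive _ _ _ X]add0r; apply: is_deriveB.
have := is_derive1_comp (g := fun t => 1 - t) (is_derive1_ln h) d1; rewrite mulrN1; exact.
Qed.

Lemma ln1D_le (R : realType) (x : R) : 0 <= x ->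
  ln (1 + x) <= x - x ^+ 2 / 2 + x ^+ 3 / 3 - x ^+ 4 / 4 + x ^+ 5 / 5.
Proof.
move=> x0.
pose p : {poly R} := 'X - (2^-1) *: 'X^2 + (3^-1) *: 'X^3 - (4^-1) *: 'X^4
  + (5^-1) *: 'X^5.
have pE t : p.[t] = t - t ^+ 2 / 2 + t ^+ 3 / 3 - t ^+ 4 / 4 + t ^+ 5 / 5.
  by rewrite /p !(hornerD,hornerN,hornerZ,hornerXn,hornerX); ring.
have dpE t : p^`().[t] = 1 - t + t ^+ 2 - t ^+ 3 + t ^+ 4.
  rewrite /p !(derivD,derivN,derivZ,derivXn,derivX)/=.
  rewrite !(hornerD,hornerN,hornerZ,hornerMn,hornerXn,hornerX,hornerC,expr0); by field.
rewrite -subr_ge0 -pE.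
have <- : p.[0] - ln (1 + 0) = 0 by rewrite pE addr0 ln1; ring.
apply: (@le_from_derive R (fun t => p.[t] - ln (1 + t))
  (fun t => p^`().[t] - (1 + t)^-1)) => // t /andP[t0 tx].
  by apply: is_deriveB; exact: is_derive_lnD1.
have h : 0 < 1 + t by rewrite ltr_wpDr.
rewrite dpE [leRHS](_ : _ = t ^+ 5 / (1 + t)).
  by rewrite divr_ge0 ?exprn_ge0// ltW.
by field; rewrite gt_eqF.
Qed.

Lemma ln1D_ge (R : realType) (x : R) : 0 <= x ->
  x - x ^+ 2 / 2 + x ^+ 3 / 3 - x ^+ 4 / 4 <= ln (1 + x).
Proof.
move=> x0.
pose p : {poly R} := 'X - (2^-1) *: 'X^2 + (3^-1) *: 'X^3 - (4^-1) *: 'X^4.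
have pE t : p.[t] = t - t ^+ 2 / 2 + t ^+ 3 / 3 - t ^+ 4 / 4.
  by rewrite /p !(hornerD,hornerN,hornerZ,hornerXn,hornerX); ring.
have dpE t : p^`().[t] = 1 - t + t ^+ 2 - t ^+ 3.
  rewrite /p !(derivD,derivN,derivZ,derivXn,derivX)/=.
  rewrite !(hornerD,hornerN,hornerZ,hornerMn,hornerXn,hornerX,hornerC,expr0); by field.
rewrite -subr_ge0 -pE.
have <- : ln (1 + 0) - p.[0] = 0 by rewrite pE addr0 ln1; ring.
apply: (@le_from_derive R (fun t => ln (1 + t) - p.[t])
  (fun t => (1 + t)^-1 - p^`().[t])) => // t /andP[t0 tx].
  by apply: is_deriveB; exact: is_derive_lnD1.
have h : 0 < 1 + t by rewrite ltr_wpDr.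
rewrite dpE [leRHS](_ : _ = t ^+ 4 / (1 + t)).
  by rewrite divr_ge0 ?exprn_ge0// ltW.
by field; rewrite gt_eqF.
Qed.

Lemma ln_series (R : realType) (x : R) (K : nat) : 0 <= x < 1 ->
  \sum_(k < K) x ^+ k.+1 / k.+1%:R <= - ln (1 - x)
    <= \sum_(k < K) x ^+ k.+1 / k.+1%:R + x ^+ K.+1 / (K.+1%:R * (1 - x)).
Proof.
move=> /andP[x0 x1].
pose p : {poly R} := \sum_(k < K) (k.+1%:R^-1) *: 'X^(k.+1).
have pE t : p.[t] = \sum_(k < K) t ^+ k.+1 / k.+1%:R.
  by rewrite horner_sum; apply: eq_bigr => k _; rewrite hornerZ hornerXn mulrC.
have dpE t : t < 1 -> p^`().[t] = (1 - t ^+ K) / (1 - t).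
  move=> t1; have h : 1 - t != 0 by rewrite gt_eqF// subr_gt0.
  apply: (mulIf h); rewrite divfK//.
  rewrite -[1 - t ^+ K]opprB subrX1 raddf_sum/= horner_sum -mulNr opprB mulrC.
  congr (_ * _); apply: eq_bigr => k _.
  rewrite derivZ derivXn hornerZ hornerMn hornerXn -[t ^+ k *+ _]mulr_natr.
  by rewrite mulrCA mulVf ?mulr1 ?pnatr_eq0.
have p0 : p.[0] = 0.
  by rewrite pE big1// => k _; rewrite expr0n/= mul0r.
have L t : 0 <= t <= x -> t < 1 by move=> /andP[_ tx]; exact: le_lt_trans tx x1.
rewrite -pE; apply/andP; split; rewrite -subr_ge0.
  have <- : - ln (1 - 0) - p.[0] = 0 by rewrite p0 !subr0 ln1 oppr0.
  apply: (@le_from_derive R (fun t => - ln (1 - t) - p.[t])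
    (fun t => - - (1 - t)^-1 - p^`().[t])) => // t /[dup] /L t1 /andP[t0 tx].
    by apply: is_deriveB; apply: is_deriveN; exact: is_derive_lnN1.
  rewrite dpE// opprK -[X in X - _]mul1r -mulrBl opprB addrCA subrr addr0.
  by rewrite divr_ge0 ?exprn_ge0// subr_ge0 ltW.
pose q : {poly R} := p + (K.+1%:R * (1 - x))^-1 *: 'X^(K.+1).
have qE t : q.[t] = p.[t] + t ^+ K.+1 / (K.+1%:R * (1 - x)).
  by rewrite /q hornerD hornerZ hornerXn [in RHS]mulrC.
have x1' : 1 - x != 0 by rewrite gt_eqF// subr_gt0.
have dqE t : q^`().[t] = p^`().[t] + t ^+ K / (1 - x).
  rewrite /q derivD derivZ derivXn hornerD hornerZ hornerMn hornerXn.
  rewrite -[t ^+ K *+ _]mulr_natr.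
  have : K.+1%:R != 0 :> R by rewrite pnatr_eq0.
  move: (K.+1%:R) => c c0; congr (_ + _); field.
  by rewrite x1' c0.
rewrite -qE opprK.
have <- : q.[0] + ln (1 - 0) = 0.
  by rewrite qE p0 !subr0 ln1 expr0n/= mul0r !addr0.
apply: (@le_from_derive R (fun t => q.[t] + ln (1 - t))
    (fun t => q^`().[t] - (1 - t)^-1)) => // t /[dup] /L t1 /andP[t0 tx].
  by apply: is_deriveD; exact: is_derive_lnN1.
rewrite dqE dpE// mulrBl mul1r addrAC -addrA addrACA subrr add0r.
rewrite addrC subr_ge0 ler_wpM2l ?exprn_ge0// lef_pV2 ?posrE ?subr_gt0//.
by rewrite lerB.
Qed.

(** * The von Mangoldt function *)

Definition vonM (R : realType) (n : nat) : R :=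
  \sum_(0 <= p < n.+1 | prime p) \sum_(1 <= k < n.+1 | (p ^ k == n)%N) ln p%:R.

Lemma vonM_widen (R : realType) (n N : nat) : (n <= N)%N ->
  vonM R n = \sum_(0 <= p < N.+1 | prime p)
    \sum_(1 <= k < N.+1 | (p ^ k == n)%N) ln p%:R.
Proof.
move=> nN; have le m : (m < n.+1)%N -> (m < N.+1)%N by move=> /leq_trans; apply.
have pk p : prime p ->
    \sum_(1 <= k < n.+1 | (p ^ k == n)%N) ln p%:R =
    \sum_(1 <= k < N.+1 | (p ^ k == n)%N) ln p%:R :> R.
  move=> pp; rewrite (big_nat_widen _ _ N.+1)//.
  apply: eq_bigl => k; case: eqP => //= <-.
  by rewrite ltnS ltnW// ltn_expl// prime_gt1.
rewrite /vonM (big_nat_widen _ _ N.+1)// big_mkcondr/=.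
apply: eq_bigr => p pp; case: ltnP => [_|np]; first exact: pk.
rewrite -pk// big_nat_cond big1// => k /andP[/andP[k1 _] /eqP e].
have : (p ^ 1 <= p ^ k)%N by rewrite leq_exp2l// prime_gt1.
by rewrite expn1 e leqNgt np.
Qed.

Lemma vonM_sum (R : realType) (phi : nat -> R) (N : nat) :
  \sum_(0 <= n < N.+1) vonM R n * phi n =
  \sum_(0 <= p < N.+1 | prime p)
    \sum_(1 <= k < N.+1 | (p ^ k <= N)%N) ln p%:R * phi (p ^ k)%N.
Proof.
transitivity (\sum_(0 <= n < N.+1) \sum_(0 <= p < N.+1 | prime p)
    \sum_(1 <= k < N.+1) (if n == (p ^ k)%N then ln p%:R * phi n else 0)).
  rewrite big_nat_cond [RHS]big_nat_cond; apply: eq_bigr => n /andP[/andP[_ nN] _].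
  rewrite (@vonM_widen _ n N)// mulr_suml; apply: eq_bigr => p _.
  rewrite mulr_suml [LHS]big_mkcond; apply: eq_bigr => k _; rewrite eq_sym.
  by case: eqP.
rewrite exchange_big/=; apply: eq_bigr => p pp.
rewrite exchange_big/= [RHS]big_mkcond; apply: eq_bigr => k _.
by rewrite -big_mkcond big_nat1_eq/= ltnS.
Qed.

Lemma vonM_ge0 (R : realType) (n : nat) : 0 <= vonM R n.
Proof.
apply: sumr_ge0 => p pp; apply: sumr_ge0 => k _.
by rewrite ln_ge0// ler1n prime_gt0.
Qed.

Lemma ln_fact_logn (R : realType) (N M : nat) : (N <= M)%N ->
  ln (N`!%:R : R) = \sum_(0 <= p < M.+1 | prime p) ln p%:R * (logn p N`!)%:R.
Proof.
elim: N => [|N IH] NM.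
  by rewrite ln1 big1// => p _; rewrite logn1 mulr0.
have n0 : (0 < N.+1)%N by [].
have lnS : ln (N.+1%:R : R) =
    \sum_(0 <= p < M.+1 | prime p) ln p%:R * (logn p N.+1)%:R.
  rewrite -[X in ln X%:R](partnT n0) (widen_partn _ NM).
  rewrite natr_prod.
  have : forall s : seq nat, ln (\prod_(p <- s) (p ^ logn p N.+1)%:R : R) =
      \sum_(p <- s | prime p) ln p%:R * (logn p N.+1)%:R.
    elim=> [|p s IHs]; first by rewrite !big_nil ln1.
    rewrite !big_cons; case: ifP => pp; last first.
      by rewrite lognE pp/= mul1r.
    rewrite lnM ?posrE ?ltr0n ?expn_gt0 ?prime_gt0//; last first.
      apply: prodr_gt0 => i _; rewrite ltr0n expn_gt0 lognE.
      by case: ifP => [/andP[/prime_gt0->]|_]; rewrite ?orbT.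
    by rewrite IHs natrX lnXn ?ltr0n ?prime_gt0// mulr_natr.
  by move=> /(_ (index_iota 0 M.+1)) <-; congr ln; apply: eq_bigl => p.
rewrite factS natrM lnM ?posrE ?ltr0n ?fact_gt0// lnS IH 1?ltnW//.
rewrite -big_split/=; apply: eq_bigr => p pp.
by rewrite lognM ?fact_gt0// natrD mulrDr.
Qed.

Lemma ln_fact_vonM (R : realType) (N : nat) :
  ln (N`!%:R : R) = \sum_(0 <= n < N.+1) vonM R n * (N %/ n)%:R.
Proof.
rewrite vonM_sum (ln_fact_logn _ (leqnn N)); apply: eq_bigr => p pp.
rewrite logn_fact// natr_sum mulr_sumr [RHS]big_mkcond/=; apply: eq_bigr => k _.
by case: leqP => // h; rewrite divn_small ?mulr0.
Qed.

Lemma ln_succ_bounds (R : realType) (n : nat) : (0 < n)%N ->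
  n%:R * (ln n.+1%:R - ln n%:R) <= 1 :> R /\
  1 <= n.+1%:R * (ln n.+1%:R - ln n%:R) :> R.
Proof.
move=> n0; have n0' : (0 : R) < n%:R by rewrite ltr0n.
have e (x : R) : 0 < x -> ln x <= x - 1.
  by move=> x0; rewrite -[in leLHS](subrK 1 x) addrC le_ln1Dx// ltrBrDr addrC subrr.
split.
  rewrite -ln_div ?posrE ?ltr0n// mulrC -ler_pdivlMr// div1r.
  apply: le_trans (e _ _) _; first by rewrite divr_gt0 ?ltr0n.
  by rewrite -natr1 mulrDl divff ?gt_eqF// mul1r addrAC subrr add0r.
rewrite -opprB -ln_div ?posrE ?ltr0n// mulrN lerNr mulrC -ler_pdivlMr ?ltr0n//.
apply: le_trans (e _ _) _; first by rewrite divr_gt0 ?ltr0n.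
rewrite -natr1 [leLHS](_ : _ = - 1 / (n%:R + 1))//.
by field; rewrite gt_eqF// ltr_wpDr.
Qed.

Lemma ln_fact_ge (R : realType) (n : nat) : (0 < n)%N ->
  n%:R * ln n%:R - n%:R + 1 <= ln n`!%:R :> R.
Proof.
case: n => // n _; elim: n => [|n IH].
  by rewrite ln1 mulr0 sub0r addNr.
rewrite factS natrM lnM ?posrE ?ltr0n ?fact_gt0//.
have [h _] := @ln_succ_bounds R n.+1 isT.
have e : n.+2%:R = n.+1%:R + 1 :> R by rewrite -natr1.
move: IH h; rewrite e; nra.
Qed.

Lemma ln_fact_le (R : realType) (n : nat) : (0 < n)%N ->
  ln n`!%:R <= n%:R * ln n%:R - n%:R + ln n%:R + 1 :> R.
Proof.
case: n => // n _; elim: n => [|n IH]; first by rewrite ln1; lra.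
rewrite factS natrM lnM ?posrE ?ltr0n ?fact_gt0//.
have [_ h] := @ln_succ_bounds R n.+1 isT.
have e : n.+2%:R = n.+1%:R + 1 :> R by rewrite -natr1.
move: IH h; rewrite e; nra.
Qed.

(** * A Chebyshev bound *)

Lemma ln_tangent (R : realType) (x y : R) : 0 < x -> 0 < y ->
  ln y <= ln x + y / x - 1.
Proof.
move=> x0 y0; have yx : 0 < y / x by rewrite divr_gt0.
have : ln (1 + (y / x - 1)) <= y / x - 1 by rewrite le_ln1Dx// ltrBrDr addrC subrr.
rewrite addrC subrK ln_div ?posrE// => h; lra.
Qed.

(* From the expansions at 16/15, 25/24 and 81/80, all of whose prime factors
   are 2, 3 and 5. *)
Lemma ln235_bounds (R : realType) :
  [/\ (693 + 145 / 1000) / 1000 <= ln (2 : R) <= (693 + 148 / 1000) / 1000,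
      (1098 + 609 / 1000) / 1000 <= ln (3 : R) <= (1098 + 613 / 1000) / 1000 &
      (1609 + 432 / 1000) / 1000 <= ln (5 : R) <= (1609 + 439 / 1000) / 1000].
Proof.
have h15 : (0 : R) <= 15^-1 by rewrite invr_ge0.
have h24 : (0 : R) <= 24^-1 by rewrite invr_ge0.
have h80 : (0 : R) <= 80^-1 by rewrite invr_ge0.
have := ln1D_ge h15; have := ln1D_le h15.
have := ln1D_ge h24; have := ln1D_le h24.
have := ln1D_ge h80; have := ln1D_le h80.
have -> : 1 + 15^-1 = (2 ^+ 4) / (3 * 5) :> R by field.
have -> : 1 + 24^-1 = (5 ^+ 2) / (2 ^+ 3 * 3) :> R by field.
have -> : 1 + 80^-1 = (3 ^+ 4) / (2 ^+ 4 * 5) :> R by field.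
rewrite !ln_div ?posrE ?mulr_gt0 ?exprn_gt0//.
rewrite !lnM ?posrE ?exprn_gt0//.
move: (ln 2) (ln 3) (ln 5) => a b c *.
by split; lra.
Qed.

Definition psi (R : realType) (N : nat) : R := \sum_(0 <= n < N.+1) vonM R n.

Lemma psi_mono (R : realType) : {homo psi R : N M / (N <= M)%N >-> N <= M}.
Proof.
move=> N M NM; rewrite /psi (@big_cat_nat _ _ _ N.+1 0%N M.+1)//=.
by rewrite lerDl sumr_ge0// => n _; exact: vonM_ge0.
Qed.

Lemma vonM0 (R : realType) : vonM R 0 = 0.
Proof. by rewrite /vonM big_mkcond big_nat1. Qed.

Lemma ln_fact_vonM_widen (R : realType) (N M : nat) : (N <= M)%N ->
  ln (N`!%:R : R) = \sum_(0 <= n < M.+1) vonM R n * (N %/ n)%:R.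
Proof.
move=> NM; rewrite ln_fact_vonM [RHS](@big_cat_nat _ _ _ N.+1 0%N M.+1)//=.
rewrite [X in _ = _ + X]big_nat_cond [X in _ = _ + X]big1 ?addr0// => n.
by move=> /andP[/andP[h _] _]; rewrite divn_small ?mulr0.
Qed.

Lemma psi_le_ln_fact (R : realType) (N : nat) : psi R N <= ln N`!%:R.
Proof.
rewrite ln_fact_vonM /psi big_nat_cond [leRHS]big_nat_cond.
apply: ler_sum => -[|n] /andP[/andP[_ nN] _]; first by rewrite vonM0 mul0r.
by rewrite ler_peMr ?vonM_ge0// ler1n divn_gt0.
Qed.

(* Chebyshev: [m - m./2 - m %/ 3 - m %/ 6] is nonnegative, and at least 1 when
   [1 <= m < 6], which for [m = 6 * k %/ n] means [k < n <= 6 * k]. *)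
Lemma psi_step (R : realType) (k : nat) :
  psi R (6 * k) <= psi R k + (ln (6 * k)`!%:R - ln (3 * k)`!%:R
                   - ln (2 * k)`!%:R - ln k`!%:R).
Proof.
have k6 : (k <= 6 * k)%N by lia.
have psik : psi R k = \sum_(0 <= n < (6 * k).+1) vonM R n * (n <= k)%:R.
  rewrite /psi (big_nat_widen _ _ (6 * k).+1)// big_mkcond.
  by apply: eq_bigr => n _; rewrite ltnS; case: leqP; rewrite ?mulr1 ?mulr0.
rewrite psik !(@ln_fact_vonM_widen R _ (6 * k)); [|lia..].
rewrite -!sumrB -big_split/= /psi.
apply: ler_sum_nat => -[|n] /andP[_ nN]; first by rewrite vonM0 !mul0r !subr0 addr0.
rewrite -!mulrBr -mulrDr ler_peMr ?vonM_ge0//.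
have h : (1 + 3 * k %/ n.+1 + 2 * k %/ n.+1 + k %/ n.+1
   <= (n.+1 <= k) + 6 * k %/ n.+1)%N.
  have -> : (3 * k %/ n.+1 = 6 * k %/ n.+1 %/ 2)%N.
    by rewrite divnAC (_ : 6 * k = 2 * (3 * k))%N ?mulKn//; lia.
  have -> : (2 * k %/ n.+1 = 6 * k %/ n.+1 %/ 3)%N.
    by rewrite divnAC (_ : 6 * k = 3 * (2 * k))%N ?mulKn//; lia.
  have -> : (k %/ n.+1 = 6 * k %/ n.+1 %/ 6)%N.
    by rewrite divnAC mulKn.
  have -> : (n.+1 <= k)%N = (6 <= 6 * k %/ n.+1)%N.
    by rewrite leq_divRL// leq_pmul2l.
  have : (1 <= 6 * k %/ n.+1)%N by rewrite divn_gt0.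
  by move: (6 * k %/ n.+1)%N => m; lia.
move: h; rewrite -(ler_nat R) !natrD; lra.
Qed.

Lemma psi_step_num (R : realType) (k : nat) : (0 < k)%N ->
  psi R (6 * k) <= psi R k + (6068 + 432 / 1000) / 1000 * k%:R + ln (6 * k)%:R - 2.
Proof.
move=> k0; apply: le_trans (psi_step R k) _.
have := @ln_fact_le R (6 * k); rewrite muln_gt0 k0 => /(_ isT).
have := @ln_fact_ge R (3 * k); rewrite muln_gt0 k0 => /(_ isT) h3.
have := @ln_fact_ge R (2 * k); rewrite muln_gt0 k0 => /(_ isT) h2.
have h1 := @ln_fact_ge R k k0.
have k0' : 0 < k%:R :> R by rewrite ltr0n.
have l2 : ln (2 * k)%:R = ln 2 + ln k%:R :> R by rewrite natrM lnM ?posrE.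
have l3 : ln (3 * k)%:R = ln 3 + ln k%:R :> R by rewrite natrM lnM ?posrE.
have l6 : ln (6 * k)%:R = ln 2 + ln 3 + ln k%:R :> R.
  have -> : (6 * k)%:R = 2 * 3 * k%:R :> R by rewrite natrM; ring.
  by rewrite !lnM ?posrE ?mulr_gt0.
move: h1 h2 h3; rewrite l2 l3 l6 !natrM.
have [/andP[_ b2] /andP[_ b3] _] := ln235_bounds R.
move: (ln (6 * k)`!%:R) (ln (3 * k)`!%:R) (ln (2 * k)`!%:R) (ln k`!%:R) (ln k%:R).
move: (ln 2) (ln 3) b2 b3 => a b b2 b3 T6 T3 T2 T1 l h1 h2 h3 h6.
have : k%:R * (4 * a + 3 * b) <= k%:R * ((6068 + 432 / 1000) / 1000) :> R.
  by rewrite ler_wpM2l//; lra.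
lra.
Qed.

Lemma psi_le (R : realType) (N : nat) : (0 < N)%N ->
  psi R N <= 122 / 100 * N%:R + 6 * ln N%:R + 20.
Proof.
have [N0] := ubnP N; elim: N0 N => // N0 IH N NN0 N_gt0.
have x0 : 0 < N%:R :> R by rewrite ltr0n.
have [N9|N9] := leqP N 9.
  apply: le_trans (@psi_mono R _ _ N9) _; apply: le_trans (psi_le_ln_fact _ _) _.
  apply: le_trans (@ln_fact_le R 9 isT) _.
  have -> : ln 9%:R = ln 3 + ln 3 :> R by rewrite -lnM ?posrE// -natrM.
  have [_ /andP[_ b3] _] := ln235_bounds R.
  have := ln_ge0 (_ : 1 <= N%:R :> R); rewrite ler1n => /(_ N_gt0) h2.
  by lra.
pose k := ((N + 5) %/ 6)%N.
have k0 : (0 < k)%N by rewrite /k; lia.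
have kN : (k < N)%N by rewrite /k; lia.
have Nk : (N <= 6 * k)%N by rewrite /k; lia.
have kN5 : (6 * k <= N + 5)%N by rewrite /k; lia.
have [/andP[a2 b2] /andP[a3 b3] /andP[a5 b5]] := ln235_bounds R.
apply: le_trans (@psi_mono R _ _ Nk) _; apply: le_trans (psi_step_num _ k0) _.
have := IH k (leq_trans kN NN0) k0.
have k0' : 0 < k%:R :> R by rewrite ltr0n.
have N5 : 0 < N%:R + 5 :> R by rewrite ltr_wpDr.
have l6 : ln (6 * k)%:R = ln 2 + ln 3 + ln k%:R :> R.
  have -> : (6 * k)%:R = 2 * 3 * k%:R :> R by rewrite natrM; ring.
  by rewrite !lnM ?posrE ?mulr_gt0.
have lk : ln 2 + ln 3 + ln k%:R <= ln (N%:R + 5) :> R.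
  by rewrite -l6 -natrD ler_ln ?posrE ?ltr0n ?muln_gt0 ?addn_gt0 ?orbT ?k0// ler_nat.
have kx : 6 * k%:R <= N%:R + 5 :> R by rewrite -natrM -natrD ler_nat.
rewrite l6.
have l50 : ln 50 = ln 2 + (ln 5 + ln 5) :> R.
  have -> : 50 = 2 * (5 * 5) :> R by ring.
  by rewrite !lnM ?posrE ?mulr_gt0.
have l200 : ln 200 = ln 2 + (ln 2 + (ln 2 + (ln 5 + ln 5))) :> R.
  have -> : 200 = 2 * (2 * (2 * (5 * 5))) :> R by ring.
  by rewrite !lnM ?posrE ?mulr_gt0.
have [N80|N80] := leqP N 80.
  have x80 : N%:R <= 80 :> R by rewrite ler_nat.
  have x10 : 10 <= N%:R :> R by rewrite ler_nat.
  have t1 := ln_tangent (_ : 0 < 50) N5; rewrite l50 in t1.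
  have t2 : ln (N%:R + 5) <= ln N%:R + (ln 3 - ln 2) :> R.
    rewrite -ln_div ?posrE// -lnM ?posrE ?divr_gt0// ler_ln ?posrE ?mulr_gt0//.
    by move: x10; clear; lra.
  have {}t1 := t1 (ltr0Sn _ _).
  by move: t1 t2 lk kx; move: (ln 2) (ln 3) (ln 5) a2 b2 a3 b3 a5 b5 => a b c; lra.
have x80 : 80 <= N%:R :> R by rewrite ler_nat ltnW.
have t1 := ln_tangent (ltr0Sn R 199) N5; rewrite l200 in t1.
have t2 : ln (N%:R + 5) <= ln N%:R + 5 / 80 :> R.
  apply: le_trans (ln_tangent x0 N5) _; rewrite -addrA lerD2l mulrDl divff ?gt_eqF//.
  by rewrite addrAC subrr add0r ler_wpM2l// lef_pV2 ?posrE.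
by move: t1 t2 lk kx; move: (ln 2) (ln 3) (ln 5) a2 b2 a3 b3 a5 b5 => a b c; lra.
Qed.

(** * Mertens' first theorem *)

Definition mertens_sum (R : realType) (N : nat) : R :=
  \sum_(0 <= n < N.+1) vonM R n / n%:R.

Lemma mertens_sum_ge (R : realType) (N : nat) : (0 < N)%N ->
  ln N%:R - 1 <= mertens_sum R N.
Proof.
move=> N0; have x0 : 0 < N%:R :> R by rewrite ltr0n.
have h : ln N`!%:R <= N%:R * mertens_sum R N :> R.
  rewrite ln_fact_vonM mulr_sumr.
  apply: ler_sum_nat => -[|n] _; first by rewrite vonM0 !mul0r mulr0.
  rewrite mulrCA ler_wpM2l ?vonM_ge0// ler_pdivlMr ?ltr0n// -natrM ler_nat.
  exact: leq_trunc_div.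
have := le_trans (@ln_fact_ge R N N0) h => h2.
rewrite -(ler_pM2l x0); apply: le_trans h2.
by rewrite mulrBr mulr1 lerDl.
Qed.

(* The right-hand side is a staircase with 12 steps over the fractional part of
   [N / n]; each step, weighted by Lambda and summed over [n], is a value of
   [psi]. *)
Lemma count_dominates_fractional_part (n N : nat) : (0 < n <= N)%N ->
  (12 * N <= 12 * (n * (N %/ n))
             + n * \sum_(k < 12) (n <= 12 * N %/ (12 + k))%N)%N.
Proof.
move=> /andP[n0 nN]; have q1 : (1 <= N %/ n)%N by rewrite divn_gt0.
have eN := divn_eq N n; have rn := ltn_pmod N n0.
set q := (N %/ n)%N in q1 eN *; set r := (N %% n)%N in eN rn.
pose j := ((12 * r) %/ n)%N.
have j12 : (j < 12)%N by rewrite /j ltn_divLR// ltn_pmul2l.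
have h : (\sum_(k < 12) (k <= j) <= \sum_(k < 12) (n <= 12 * N %/ (12 + k)))%N.
  apply: leq_sum => k _; have [kj|//] := leqP k j.
  suff -> : (n <= 12 * N %/ (12 + k))%N by [].
  rewrite leq_divRL//.
  have : (k * n <= 12 * r)%N by rewrite -leq_divRL.
  by rewrite eN; nia.
have e : (\sum_(k < 12) (k <= j) = j.+1)%N.
  by rewrite !big_ord_recr big_ord0/=; lia.
have h2 : (12 * r < j.+1 * n)%N by apply: ltn_ceil.
have e12 : (12 * N = 12 * (n * q) + 12 * r)%N by rewrite {1}eN; lia.
rewrite [X in (X <= _)%N]e12 leq_add2l; apply: leq_trans (ltnW h2) _.
by rewrite mulnC leq_pmul2l// -e.
Qed.

Lemma mertens_sum_le_psi (R : realType) (N : nat) :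
  12 * (N%:R * mertens_sum R N) <=
    12 * ln N`!%:R + \sum_(k < 12) psi R (12 * N %/ (12 + k)).
Proof.
have e (k : 'I_12) : psi R (12 * N %/ (12 + k)) =
    \sum_(0 <= n < N.+1) vonM R n * (n <= 12 * N %/ (12 + k))%:R.
  have le : (12 * N %/ (12 + k) <= N)%N.
    rewrite -[leqRHS](@mulKn N 12)//; exact: leq_div2l.
  rewrite /psi (big_nat_widen _ _ N.+1)// big_mkcond.
  by apply: eq_bigr => n _; rewrite ltnS; case: leqP; rewrite ?mulr1 ?mulr0.
under [X in _ <= _ + X]eq_bigr do rewrite e.
rewrite exchange_big/= ln_fact_vonM !mulr_sumr -big_split/=.
apply: ler_sum_nat => -[|n] /andP[_ nN].
  by rewrite vonM0 !mul0r !mulr0 add0r sumr_ge0// => k _; rewrite mul0r.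
rewrite -mulr_sumr [12 * (vonM _ _ * _)]mulrCA -mulrDr.
rewrite [N%:R * _]mulrCA [12 * _]mulrCA ler_wpM2l ?vonM_ge0//.
rewrite mulrA ler_pdivrMr ?ltr0n// -natr_sum -!natrM -natrD -natrM ler_nat.
apply: leq_trans (@count_dominates_fractional_part n.+1 N nN) _.
by rewrite mulnDl -mulnA [(N %/ _ * _)%N]mulnC leq_add2l mulnC.
Qed.

Lemma mertens_sum_le (R : realType) (N : nat) : (1 < N)%N ->
  mertens_sum R N <= ln N%:R - 128 / 1000 + (7 * ln N%:R + 21) / N%:R.
Proof.
move=> N1; have N0 : (0 < N)%N by apply: ltnW.
have x0 : 0 < N%:R :> R by rewrite ltr0n.
have psik (k : 'I_12) : psi R (12 * N %/ (12 + k)) <=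
    122 / 100 * (12 * N%:R) * (12 + k)%:R^-1 + (6 * ln N%:R + 20).
  have M0 : (0 < 12 * N %/ (12 + k))%N.
    by rewrite divn_gt0//; have := ltn_ord k; lia.
  have MN : (12 * N %/ (12 + k) <= N)%N.
    by rewrite -[leqRHS](@mulKn N 12)//; exact: leq_div2l.
  apply: le_trans (psi_le R M0) _; rewrite -addrA; apply: lerD.
    rewrite -[leRHS]mulrA ler_wpM2l// ler_pdivlMr ?ltr0n// -!natrM ler_nat.
    exact: leq_trunc_div.
  by rewrite lerD2r ler_wpM2l// ler_ln ?posrE ?ltr0n// ler_nat.
have hs : \sum_(k < 12) psi R (12 * N %/ (12 + k)) <=
    122 / 100 * (12 * N%:R) * (7145 / 10000) + 12 * (6 * ln N%:R + 20).
  apply: le_trans (ler_sum _ (fun k _ => psik k)) _.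
  rewrite big_split/=; apply: lerD; last by rewrite sumr_const card_ord -[leLHS]mulr_natl.
  rewrite -mulr_sumr.
  rewrite ler_wpM2l ?mulr_ge0//.
  rewrite !big_ord_recr big_ord0/=.
  apply: (@le_trans _ _ (0 + 12^-1 + 13^-1 + 14^-1 + 15^-1 + 16^-1 + 17^-1
    + 18^-1 + 19^-1 + 20^-1 + 21^-1 + 22^-1 + 23^-1));
    [exact: lexx | lra].
have := mertens_sum_le_psi R N; have := @ln_fact_le R N N0 => hT hP.
rewrite -(ler_pM2l x0).
have -> : N%:R * (ln N%:R - 128 / 1000 + (7 * ln N%:R + 21) / N%:R) =
    N%:R * ln N%:R - 128 / 1000 * N%:R + (7 * ln N%:R + 21) :> R.
  by field; rewrite gt_eqF.
move: hs hT hP; move: (mertens_sum R N) (ln N`!%:R) => S T.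
move: (\sum_(k < 12) _) (ln N%:R) => P l; lra.
Qed.

Lemma ln_10000 (R : realType) : ln (100 ^ 2)%:R = 4 * (ln 2 + ln 5) :> R.
Proof.
have -> : (100 ^ 2)%:R = (2 * 5) ^+ 4 :> R by rewrite natrX; ring.
by rewrite lnXn ?mulr_gt0// lnM ?posrE//; ring.
Qed.

Lemma ln_ge_10000 (R : realType) (N : nat) : (100 ^ 2 <= N)%N ->
  921 / 100 <= ln N%:R :> R.
Proof.
move=> hN; apply: (@le_trans _ _ (ln (100 ^ 2)%:R)).
  rewrite ln_10000; have [/andP[h2 _] _ /andP[h5 _]] := ln235_bounds R.
  by lra.
by rewrite ler_ln ?posrE ?ltr0n ?ler_nat// (leq_trans _ hN).
Qed.

Lemma mertens_sum_bounds (R : realType) (N : nat) : (100 ^ 2 <= N)%N ->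
  -1 <= mertens_sum R N - ln N%:R <= - (119 / 1000).
Proof.
move=> hN; have N1 : (1 < N)%N by apply: leq_trans hN.
have x0 : 0 < N%:R :> R by rewrite ltr0n ltnW.
have xN : 100 * 100 <= N%:R :> R by rewrite -natrM ler_nat.
apply/andP; split.
  by have := mertens_sum_ge R (ltnW N1); lra.
have := mertens_sum_le R N1.
have h : (7 * ln N%:R + 21) / N%:R <= 9 / 1000 :> R.
  rewrite ler_pdivrMr//.
  have h0 : 0 < (100 ^ 2)%:R :> R by rewrite ltr0n.
  have := ln_tangent h0 x0; rewrite ln_10000 natrX.
  have [/andP[_ h2] _ /andP[_ h5]] := ln235_bounds R.
  move: (ln 2) (ln 5) (ln N%:R) h2 h5 => a b l; lra.
lra.
Qed.

(** * The constant in Mertens' second theorem *)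

Definition mangoldt_sum (R : realType) (N : nat) : R :=
  \sum_(0 <= n < N.+1) vonM R n / (n%:R * ln n%:R).

Definition mertens_error (R : realType) (N : nat) : R :=
  mertens_sum R N - ln N%:R.

Definition mangoldt_defect (R : realType) (N : nat) : R :=
  mangoldt_sum R N - ln (ln N%:R).

Lemma mangoldt_step (R : realType) (n : nat) : (2 < n)%N ->
  mertens_error R n.+1 / ln n.+1%:R - mertens_error R n / ln n.+1%:R
    - (n.-1%:R^-1 - n%:R^-1)
  <= mangoldt_defect R n.+1 - mangoldt_defect R n
  <= mertens_error R n.+1 / ln n.+1%:R - mertens_error R n / ln n.+1%:R.
Proof.
pose r := mertens_error R; rewrite -mulrBl -/r => n2.
have n0 : 0 < n%:R :> R by rewrite ltr0n (leq_ltn_trans _ n2).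
have l1 : 1 <= ln n%:R :> R.
  have [_ /andP[h _] _] := ln235_bounds R.
  have : ln 3 <= ln n%:R :> R by rewrite ler_ln ?posrE ?ler_nat//.
  by lra.
have l0 : 0 < ln n%:R :> R by exact: lt_le_trans l1.
have ll' : ln n%:R <= ln n.+1%:R :> R by rewrite ler_ln ?posrE// ler_nat.
have l'0 : 0 < ln n.+1%:R :> R by exact: lt_le_trans ll'.
have d1 : ln n.+1%:R <= ln n%:R + n%:R^-1 :> R.
  apply: le_trans (ln_tangent n0 (ltr0Sn R n)) _.
  by rewrite -natr1 mulrDl divff ?gt_eqF// mul1r; lra.
have eM : mangoldt_sum R n.+1 - mangoldt_sum R n =
    (mertens_sum R n.+1 - mertens_sum R n) / ln n.+1%:R.
  rewrite /mangoldt_sum /mertens_sum ![\sum_(0 <= _ < n.+2) _]big_nat_recr//=.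
  by rewrite ![_ + _ - _]addrAC !subrr !add0r invfM mulrA.
have eS : mertens_sum R n.+1 - mertens_sum R n =
    r n.+1 - r n + (ln n.+1%:R - ln n%:R) by rewrite /r /mertens_error; ring.
have -> : mangoldt_defect R n.+1 - mangoldt_defect R n =
   (r n.+1 - r n) / ln n.+1%:R + ((ln n.+1%:R - ln n%:R) / ln n.+1%:R
      - (ln (ln n.+1%:R) - ln (ln n%:R))).
  rewrite /mangoldt_defect opprD opprK addrACA eM eS; ring.
have t1 := ln_tangent l'0 l0; have t2 := ln_tangent l0 l'0.
move: (ln (ln n.+1%:R)) (ln (ln n%:R)) t1 t2 => a b t1 t2.
move: l1 l0 ll' l'0 d1 t1 t2; move: (ln n%:R) (ln n.+1%:R) => l l' l1 l0 ll' l'0 d1 t1 t2.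
have -> : (l' - l) / l' = 1 - l / l' by field; rewrite gt_eqF.
apply/andP; split; last by lra.
have h : l' / l - 1 - (1 - l / l') <= n.-1%:R^-1 - n%:R^-1.
  have -> : l' / l - 1 - (1 - l / l') = (l' - l) ^+ 2 / (l * l').
    by field; rewrite !gt_eqF.
  have m0 : 0 < n.-1%:R :> R by rewrite ltr0n -subn1 subn_gt0 (leq_trans _ n2).
  have -> : n.-1%:R^-1 - n%:R^-1 = (n.-1%:R * n%:R)^-1 :> R.
    have en : n%:R = n.-1%:R + 1 :> R by rewrite natr1 prednK// (leq_trans _ n2).
    rewrite en; field; rewrite ?gt_eqF// -en//.
  rewrite ler_pdivrMr ?mulr_gt0// mulrC.
  apply: (@le_trans _ _ (n%:R ^- 2)).
    rewrite -exprVn lerXn2r// ?nnegrE ?subr_ge0 ?invr_ge0 ?(ltW n0)//; lra.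
  apply: (@le_trans _ _ (n.-1%:R * n%:R)^-1).
    rewrite lef_pV2 ?posrE ?mulr_gt0 ?exprn_gt0// expr2 ler_wpM2r ?(ltW n0)//.
    by rewrite ler_nat leq_pred.
  by rewrite ler_peMl ?invr_ge0 ?mulr_ge0 ?(ltW m0) ?(ltW n0)//; nra.
by lra.
Qed.

Lemma mangoldt_defect_osc (R : realType) (a b : R) (N n : nat) :
  (2 < N)%N -> (N <= n)%N ->
  (forall m, (N <= m)%N -> a <= mertens_error R m <= b) ->
  - ((b - a) / ln N%:R + N.-1%:R^-1)
  <= mangoldt_defect R n - mangoldt_defect R N <= (b - a) / ln N%:R.
Proof.
move=> N2 Nn hr; pose r := mertens_error R.
have l0 m : (N <= m)%N -> 0 < ln m%:R :> R.
  by move=> Nm; rewrite ln_gt0// ltr1n (leq_trans _ Nm)// ltnW.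
have ll m : (N <= m)%N -> (ln m.+1%:R)^-1 <= (ln m%:R)^-1 :> R.
  move=> Nm; rewrite lef_pV2 ?posrE ?l0 ?leqW//.
  have m0 : (0 < m)%N by rewrite (leq_trans _ Nm)// (leq_trans _ N2).
  by rewrite ler_ln ?posrE ?ltr0n// ler_nat.
have inv : (r n - a) / ln n%:R - (b - a) / ln N%:R - (N.-1%:R^-1 - n.-1%:R^-1)
    <= mangoldt_defect R n - mangoldt_defect R N
    <= (r n - b) / ln n%:R + (b - a) / ln N%:R.
  move: Nn; elim: n => [|n IH]; first by rewrite leqNgt (leq_ltn_trans _ N2).
  rewrite leq_eqVlt => /orP[/eqP <-|Nn].
    have /andP[ra rb] := hr _ (leqnn N); have := l0 _ (leqnn N) => lN.
    rewrite subrr -!mulrBl -mulrDl.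
    rewrite subrr subr0 pmulr_lle0 ?pmulr_lge0 ?invr_gt0// -/(r N).
    by apply/andP; split; move: ra rb; rewrite -/(r N); lra.
  have /andP[I1 I2] := IH Nn.
  have /andP[s1 s2] := @mangoldt_step R n (leq_trans N2 Nn).
  have /andP[ra rb] := hr _ Nn; have := ll _ Nn.
  move: s1 s2 I1 I2; rewrite -/(r n) -/(r n.+1) /=.
  move: ra rb; rewrite -/(r n).
  move: (mangoldt_defect R n.+1) (mangoldt_defect R n) (mangoldt_defect R N).
  move: (r n.+1) (r n) ((ln n.+1%:R)^-1) ((ln n%:R)^-1) ((ln N%:R)^-1).
  move: (n.-1%:R^-1) (n%:R^-1) (N.-1%:R^-1) => p q s rn' rn i' i iN d' d dN.
  move=> ra rb s1 s2 I1 I2 ii.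
  have h1 : (rn - a) * i' <= (rn - a) * i by rewrite ler_wpM2l// subr_ge0.
  have h2 : (b - rn) * i' <= (b - rn) * i by rewrite ler_wpM2l// subr_ge0.
  by apply/andP; split; lra.
have /andP[I1 I2] := inv; have /andP[ra rb] := hr _ Nn.
have ln0 := l0 _ Nn.
have p1 : 0 <= (r n - a) / ln n%:R by rewrite divr_ge0 ?(ltW ln0)// subr_ge0.
have p2 : 0 <= (b - r n) / ln n%:R by rewrite divr_ge0 ?(ltW ln0)// subr_ge0.
have p3 : 0 <= n.-1%:R^-1 :> R by rewrite invr_ge0.
by apply/andP; split; lra.
Qed.

(* 881/1000 is the length of the interval in [mertens_sum_bounds]. *)
Definition osc_bound (R : realType) (N : nat) : R :=
  881 / 1000 / ln N%:R + N.-1%:R^-1.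

Lemma mangoldt_limit (R : realType) :
  {c : R | forall N, (100 ^ 2 <= N)%N ->
    `|mangoldt_defect R N - c| <= osc_bound R N}.
Proof.
pose a := @mangoldt_defect R; pose w := @osc_bound R.
have osc N n : (100 ^ 2 <= N)%N -> (N <= n)%N -> - w N <= a n - a N <= w N.
  move=> hN Nn; have N2 : (2 < N)%N by apply: leq_trans hN.
  have := @mangoldt_defect_osc R (-1) (- (119 / 1000)) N n N2 Nn.
  have <- : 881 / 1000 = - (119 / 1000) - (-1) :> R by lra.
  move=> /(_ _)/andP[|h1 h2].
    by move=> m Nm; apply: mertens_sum_bounds; apply: leq_trans Nm.
  apply/andP; split=> //; apply: le_trans h2 _.
  by rewrite /w /osc_bound lerDl invr_ge0.
have both N n : (100 ^ 2 <= N)%N -> (100 ^ 2 <= n)%N -> a N - w N <= a n + w n.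
  have w0 m : (100 ^ 2 <= m)%N -> 0 <= w m.
    move=> hm; have := osc _ _ hm (leqnn _); lra.
  move=> hN hn; case: (leqP N n) => [Nn|/ltnW nN].
    by have /andP[] := osc _ _ hN Nn; have := w0 _ hn; lra.
  by have /andP[] := osc _ _ hn nN; have := w0 _ hN; lra.
pose E := [set a N - w N | N in [set N | (100 ^ 2 <= N)%N]].
exists (sup E) => N hN; rewrite ler_distlC; apply/andP; split.
  apply: (@sup_upper_bound _ E); last by exists N.
  split; first by exists (a N - w N); exists N.
  by exists (a N + w N) => _ [m hm <-]; exact: both.
apply: ge_sup; first by exists (a N - w N); exists N.
by move=> _ [m hm <-]; exact: both.
Qed.

Lemma prime_inv_bounds (R : realType) (p : nat) : prime p ->
  0 < (p%:R^-1 : R) <= 2^-1.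
Proof.
move=> pp; rewrite invr_gt0 ltr0n prime_gt0// lef_pV2 ?posrE ?ltr0n ?prime_gt0//.
by rewrite ler_nat prime_gt1.
Qed.

Lemma mertens_product_gt0 (R : realType) (q : nat) : 0 < mertens_product R q.
Proof.
apply: prodr_gt0 => p pp.
by have /andP[_] := prime_inv_bounds R pp; lra.
Qed.

Lemma ln_mertens_product (R : realType) (q : nat) :
  - ln (mertens_product R q) = \sum_(0 <= p < q | prime p) - ln (1 - p%:R^-1).
Proof.
elim: q => [|q IH]; first by rewrite /mertens_product !big_geq// ln1 oppr0.
rewrite /mertens_product big_mkcond [RHS]big_mkcond/= !big_nat_recr//=.
rewrite -!big_mkcond/= -IH; case: ifP => pq; last by rewrite mulr1 addr0.
have /andP[_ h] := prime_inv_bounds R pq.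
rewrite lnM ?posrE ?opprD//; last by lra.
exact: mertens_product_gt0.
Qed.

Lemma mangoldt_sumE (R : realType) (N : nat) :
  mangoldt_sum R N = \sum_(0 <= p < N.+1 | prime p)
    \sum_(k < trunc_log p N) p%:R^-1 ^+ k.+1 / k.+1%:R.
Proof.
rewrite /mangoldt_sum (vonM_sum (fun n => (n%:R * ln n%:R)^-1)).
apply: eq_bigr => p pp; have p1 := prime_gt1 pp.
have lp : ln p%:R != 0 :> R by rewrite gt_eqF// ln_gt0// ltr1n.
rewrite big_add1/= -(big_mkord xpredT (fun k => p%:R^-1 ^+ k.+1 / k.+1%:R)).
case: N => [|N].
  by rewrite trunc_log0 !big_geq.
have tN : (trunc_log p N.+1 <= N.+1)%N.
  by apply: leq_trans (ltnW (ltn_expl _ p1)) _; rewrite trunc_logP.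
rewrite [RHS](big_nat_widen _ _ N.+1)//; apply: eq_big => [k|k _].
  apply/idP/idP => [|h]; first exact: trunc_log_max.
  by apply: leq_trans (@trunc_logP p N.+1 p1 isT); rewrite leq_exp2l.
rewrite natrX lnXn ?ltr0n ?prime_gt0// exprVn -[ln _ *+ _]mulr_natl.
have : p%:R ^+ k.+1 != 0 :> R by rewrite expf_neq0// pnatr_eq0 -lt0n ltnW.
have : k.+1%:R != 0 :> R by rewrite pnatr_eq0.
move: lp; move: (ln p%:R) (p%:R ^+ k.+1) (k.+1%:R) => a b c a0 c0 b0.
by field; rewrite a0 b0 c0.
Qed.

Lemma mangoldt_sum_le (R : realType) (N : nat) :
  mangoldt_sum R N <= - ln (mertens_product R N.+1).
Proof.
rewrite mangoldt_sumE ln_mertens_product; apply: ler_sum => p pp.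
have /andP[h1 h2] := prime_inv_bounds R pp.
have /(@ln_series R _ (trunc_log p N))/andP[] // : 0 <= (p%:R^-1 : R) < 1.
by rewrite (ltW h1)/=; lra.
Qed.

Lemma mangoldt_sum_ge (R : realType) (N s : nat) : (0 < s)%N -> (s ^ 2 <= N)%N ->
  - ln (mertens_product R N.+1) <= mangoldt_sum R N + 7 / 6 / s%:R.
Proof.
move=> s0 sN; have sN' : (s <= N)%N by apply: leq_trans sN; rewrite -{1}[s]expn1 leq_pexp2l.
have N0 : (0 < N)%N by exact: leq_trans sN'.
have s0' : 0 < s%:R :> R by rewrite ltr0n.
have N0' : 0 < N%:R :> R by rewrite ltr0n.
pose g p : R := if (p <= s)%N then 2 / 3 / N%:R
  else 2^-1 * (- (p.+1.-1)%:R^-1 - - (p.-1)%:R^-1).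
have g0 p : (0 < p)%N -> 0 <= g p.
  move=> p0; rewrite /g; case: ifP => [_|/negbT]; first by rewrite !mulr_ge0.
  rewrite -ltnNge => sp /=; rewrite opprK mulr_ge0// addrC subr_ge0.
  have p1 : (0 < p.-1)%N by rewrite -subn1 subn_gt0; exact: leq_ltn_trans sp.
  by rewrite lef_pV2 ?posrE ?ltr0n// ler_nat leq_pred.
have hp p : prime p -> (p <= N)%N -> - ln (1 - p%:R^-1) <=
    \sum_(k < trunc_log p N) p%:R^-1 ^+ k.+1 / k.+1%:R + g p.
  move=> pp pN; have /andP[h1 h2] := prime_inv_bounds R pp.
  have /(@ln_series R _ (trunc_log p N))/andP[_ h] : 0 <= (p%:R^-1 : R) < 1.
    by rewrite (ltW h1)/=; lra.
  apply: le_trans h _; rewrite lerD2l.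
  have p1 := prime_gt1 pp; have p0 := prime_gt0 pp.
  set K := trunc_log p N.
  have h1x : 2^-1 <= 1 - p%:R^-1 :> R by lra.
  have x10 : 0 < 1 - p%:R^-1 :> R by lra.
  rewrite /g; case: ifP => [ps|/negbT].
    have K2 : (2 <= K)%N.
      by apply: trunc_log_max => //; apply: leq_trans sN; rewrite leq_exp2r.
    rewrite mulrC; apply: ler_pM; rewrite ?invr_ge0 ?exprn_ge0 ?mulr_ge0 ?(ltW x10) ?(ltW h1)//.
      rewrite -[2 / 3]invrK lef_pV2 ?posrE ?invr_gt0 ?mulr_gt0//.
      have : 3 <= K.+1%:R :> R by rewrite ler_nat.
      by rewrite invfM invrK; nra.
    rewrite exprVn lef_pV2 ?posrE ?exprn_gt0 ?ltr0n// -natrX ler_nat.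
    by rewrite ltnW// trunc_log_ltn.
  move=> _ /=.
  have K1 : (1 <= K)%N by apply: trunc_log_max => //; rewrite expn1.
  have p1' : 0 < p.-1%:R :> R by rewrite ltr0n -subn1 subn_gt0.
  have -> : 2^-1 * (- p%:R^-1 - - p.-1%:R^-1) = p%:R^-1 ^+ 2 / (2 * (1 - p%:R^-1)) :> R.
    have ep : p%:R = p.-1%:R + 1 :> R by rewrite natr1 prednK.
    rewrite ep; field.
    by rewrite addrK -ep !gt_eqF// ltr0n.
  apply: ler_pM; rewrite ?invr_ge0 ?exprn_ge0 ?mulr_ge0 ?(ltW x10) ?(ltW h1)//.
    by apply: ler_wiXn2l; rewrite ?(ltW h1)//; lra.
  rewrite lef_pV2 ?posrE ?mulr_gt0// ler_wpM2r ?(ltW x10)//.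
  by rewrite ler_nat.
rewrite ln_mertens_product mangoldt_sumE.
apply: (@le_trans _ _ (\sum_(0 <= p < N.+1 | prime p)
  (\sum_(k < trunc_log p N) p%:R^-1 ^+ k.+1 / k.+1%:R + g p))).
  rewrite big_nat_cond [leRHS]big_nat_cond; apply: ler_sum => p.
  by move=> /andP[/andP[_ pN] pp]; exact: hp.
rewrite big_split/= lerD2l.
apply: (@le_trans _ _ (\sum_(1 <= p < N.+1) g p)).
  rewrite big_mkcond big_ltn//= add0r; apply: ler_sum_nat => p /andP[p0 _].
  by case: ifP => // _; exact: g0.
rewrite (@big_cat_nat _ _ _ s.+1)//=.
have -> : \sum_(1 <= p < s.+1) g p = s%:R * (2 / 3 / N%:R).
  rewrite (eq_big_nat _ _ (F2 := fun=> 2 / 3 / N%:R)).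
    by rewrite sumr_const_nat subn1/= -[LHS]mulr_natl.
  by move=> p /andP[_ ps]; rewrite /g -ltnS ps.
have -> : \sum_(s.+1 <= p < N.+1) g p = 2^-1 * (- N%:R^-1 - - s%:R^-1).
  rewrite (eq_big_nat _ _ (F2 := fun p => 2^-1 * (- (p.+1.-1)%:R^-1 - - (p.-1)%:R^-1))).
    rewrite -mulr_sumr (@telescope_sumr _ s.+1 N.+1 (fun p => - (p.-1)%:R^-1))//.
  by move=> p /andP[sp _]; rewrite /g leqNgt sp.
have h1 : s%:R * (2 / 3 / N%:R) <= 2 / 3 / s%:R :> R.
  rewrite mulrCA ler_wpM2l// ler_pdivrMr// mulrC ler_pdivlMr//.
  by rewrite -expr2 -natrX ler_nat.
have h2 : 0 <= N%:R^-1 :> R by rewrite invr_ge0.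
lra.
Qed.

(** * Dirichlet series over sets of integers *)

Lemma esum_nat_le (R : realType) (S : set nat) (f : nat -> R) (B : R) :
  (forall r : seq nat, uniq r -> (forall n, n \in r -> S n) ->
    \sum_(n <- r) f n <= B) ->
  (\esum_(n in S) (f n)%:E <= B%:E)%E.
Proof.
move=> H; apply: ge_ereal_sup => _ [F [finF FS] <-].
rewrite fsbig_finite//= sumEFin lee_fin; apply: H; first exact: fset_uniq.
by move=> n; rewrite in_fset_set// => /set_mem/FS.
Qed.

Lemma le_esum_nat (R : realType) (S : set nat) (f : nat -> R) (r : seq nat) :
  uniq r -> (forall n, n \in r -> S n) ->
  ((\sum_(n <- r) f n)%:E <= \esum_(n in S) (f n)%:E)%E.
Proof.
move=> ur rS; rewrite -sumEFin; apply: esum_ge.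
exists [set` r]; last by rewrite fsbig_seq.
by split => [|n /= /rS//]; exact: finite_seq.
Qed.

Lemma ler_sum_subseq (R : realType) (f : nat -> R) (r r' : seq nat) :
  (forall n, 0 <= f n) -> uniq r -> uniq r' -> {subset r <= r'} ->
  \sum_(n <- r) f n <= \sum_(n <- r') f n.
Proof.
move=> f0 ur ur' rr'.
rewrite (perm_big [seq n <- r' | n \in r]); last first.
  apply: uniq_perm; rewrite ?filter_uniq// => n; rewrite mem_filter.
  by apply/idP/andP => [nr|[]//]; split=> //; exact: rr'.
rewrite big_filter big_mkcond/=; apply: ler_sum => n _.
by case: ifP.
Qed.

Definition zeta_weight (R : realType) (s : R) (n : nat) : R := n%:R `^ (- s).

(* Only meaningful for [1 < s]: otherwise [fine] may send [+oo] to 0. *)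
Definition zeta_on (R : realType) (s : R) (S : set nat) : R :=
  fine (\esum_(n in S) (zeta_weight s n)%:E).

Section zeta_on_theory.
Context {R : realType}.
Variable s : R.
Hypothesis s1 : 1 < s.

Lemma zeta_weight_ge0 n : 0 <= zeta_weight s n.
Proof. exact: powR_ge0. Qed.

Lemma zeta_weightM m n : zeta_weight s (m * n) = zeta_weight s m * zeta_weight s n.
Proof. by rewrite /zeta_weight natrM powRM. Qed.

Lemma zeta_weight_le n : (0 < n)%N ->
  zeta_weight s n.+1 <= (s - 1)^-1 * (n%:R `^ (1 - s) - n.+1%:R `^ (1 - s)).
Proof.
move=> n0; have s0 : 0 < s - 1 by rewrite subr_gt0.
have n0' : 0 < n%:R :> R by rewrite ltr0n.
have -> : zeta_weight s n.+1 = n.+1%:R `^ (1 - s) / n.+1%:R :> R.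
  rewrite /zeta_weight -(powR_inv1 (ler0n R n.+1)) -powRD.
    by congr (_ `^ _); ring.
  by apply/implyP => _; rewrite pnatr_eq0.
have -> : n%:R `^ (1 - s) =
    n.+1%:R `^ (1 - s) * expR ((s - 1) * (ln n.+1%:R - ln n%:R)) :> R.
  rewrite /powR !gt_eqF// -expRD; congr expR; ring.
have h : (s - 1) / n.+1%:R <= (s - 1) * (ln n.+1%:R - ln n%:R).
  rewrite ler_wpM2l ?(ltW s0)//.
  by rewrite -[n.+1%:R^-1]mul1r ler_pdivrMr// mulrC; have [] := @ln_succ_bounds R n n0.
have p0 := powR_ge0 (n.+1%:R : R) (1 - s).
have h2 := le_trans (lerD (lexx 1) h) (expR_ge1Dx _).
rewrite ler_pdivlMl//; have := ler_wpM2l p0 h2.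
move: (_ `^ _) (expR _) (n.+1%:R^-1) => A E i; lra.
Qed.

Lemma zeta_weight_sum_le N :
  \sum_(0 <= n < N.+1) zeta_weight s n <= 1 + (s - 1)^-1.
Proof.
have s0 : 0 < s - 1 by rewrite subr_gt0.
have w0 : zeta_weight s 0 = 0.
  by rewrite /zeta_weight powR0// oppr_eq0 gt_eqF// (lt_trans _ s1).
case: N => [|N]; first by rewrite big_nat1 w0 addr_ge0// invr_ge0 ltW.
suff h : \sum_(0 <= n < N.+2) zeta_weight s n <=
    1 + (s - 1)^-1 * (1 - N.+1%:R `^ (1 - s)).
  apply: le_trans h _; have := powR_ge0 (N.+1%:R : R) (1 - s).
  have : 0 <= (s - 1)^-1 by rewrite invr_ge0 ltW.
  by move: (_ `^ _) (s - 1)^-1 => A i; nra.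
elim: N => [|N IH].
  by rewrite !big_nat_recr//= big_geq// w0 !add0r /zeta_weight !powR1 subrr mulr0 addr0.
rewrite big_nat_recr//=; have := @zeta_weight_le N.+1 isT; move: IH.
move: (\sum_(0 <= _ < _) _) (zeta_weight _ _) (_ `^ _) (_ `^ _) => a b c d.
lra.
Qed.

Lemma esum_zeta_le (S : set nat) :
  (\esum_(n in S) (zeta_weight s n)%:E <= (1 + (s - 1)^-1)%:E)%E.
Proof.
apply: esum_nat_le => r ur _; pose N := (\max_(n <- r) n)%N.
apply: le_trans (zeta_weight_sum_le N).
apply: ler_sum_subseq => //; [exact: zeta_weight_ge0|exact: iota_uniq|].
by move=> n nr; rewrite mem_index_iota ltnS leq_bigmax_seq.
Qed.

Lemma esum_zetaE S : \esum_(n in S) (zeta_weight s n)%:E = (zeta_on s S)%:E.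
Proof.
rewrite /zeta_on fineK// ge0_fin_numE; last first.
  by apply: esum_ge0 => n _; rewrite lee_fin zeta_weight_ge0.
by apply: le_lt_trans (esum_zeta_le S) _; rewrite ltry.
Qed.

Lemma zeta_on_le S : zeta_on s S <= 1 + (s - 1)^-1.
Proof. by rewrite -lee_fin -esum_zetaE; exact: esum_zeta_le. Qed.

Lemma zeta_on_ge0 S : 0 <= zeta_on s S.
Proof. by apply: fine_ge0; apply: esum_ge0 => n _; rewrite lee_fin zeta_weight_ge0. Qed.

Lemma zeta_onID S B : zeta_on s S = zeta_on s (S `&` B) + zeta_on s (S `&` ~` B).
Proof.
apply/EFin_inj; rewrite EFinD -!esum_zetaE; apply: esumID => n _.
by rewrite lee_fin zeta_weight_ge0.
Qed.

Lemma zeta_on_dilate S d : (0 < d)%N ->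
  zeta_on s [set (d * n)%N | n in S] = zeta_weight s d * zeta_on s S.
Proof.
move=> d0; apply/EFin_inj; rewrite -esum_zetaE esum_image; last first.
  by move=> m n _ _ /eqP; rewrite eqn_pmul2l// => /eqP.
under eq_esum do rewrite zeta_weightM EFinM.
rewrite EFinM -esum_zetaE.
have h (c : R) (f : nat -> R) : 0 <= c -> (forall n, 0 <= f n) ->
    (\esum_(n in S) (c%:E * (f n)%:E) <= c%:E * \esum_(n in S) (f n)%:E)%E.
  move=> c0 f0; apply: ge_ereal_sup => _ [F [finF FS] <-].
  rewrite -ge0_mule_fsumr; last by move=> n; rewrite lee_fin.
  by apply: lee_pmul => //; [apply: fsume_ge0 => n _; rewrite lee_fin|
    apply: ereal_sup_ubound; exists F].
apply/eqP; rewrite eq_le h ?zeta_weight_ge0//=; last exact: zeta_weight_ge0.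
have d0' : 0 < zeta_weight s d by apply: powR_gt0; rewrite ltr0n.
rewrite -lee_pdivlMl//.
have := h (zeta_weight s d)^-1 (fun n => zeta_weight s d * zeta_weight s n).
rewrite invr_ge0 zeta_weight_ge0 => /(_ isT).
move=> /(_ (fun n => mulr_ge0 (zeta_weight_ge0 d) (zeta_weight_ge0 n))).
apply: le_trans; rewrite le_eqVlt; apply/orP; left; apply/eqP.
by apply: eq_esum => n _; rewrite -EFinM mulKf// gt_eqF.
Qed.

End zeta_on_theory.

(** * The density inequality for primitive sets *)

Definition smooth_set (T : pred nat) : set nat :=
  [set n | (0 < n)%N /\ forall r, prime r -> (r %| n)%N -> T r].

Lemma zeta_rough (R : realType) (s : R) (T : pred nat) (q : nat) : 1 < s ->
  zeta_on s (smooth_set (fun r => T r && (q <= r)%N)) =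
  zeta_on s (smooth_set T) *
    \prod_(0 <= r < q | prime r && T r) (1 - zeta_weight s r).
Proof.
move=> s1; elim: q => [|q IH].
  rewrite big_geq// mulr1; congr zeta_on; apply/seteqP; split=> n [n0 h];
    by split=> // r pr rn; have := h r pr rn; rewrite leq0n andbT.
rewrite big_mkcond big_nat_recr//= -big_mkcond/= mulrA -IH.
set U := smooth_set _; set V := smooth_set _.
case: ifP => [/andP[pq Tq]|nq]; last first.
  rewrite mulr1; congr zeta_on; apply/seteqP; split=> n [n0 h]; split=> // r pr rn.
    by have /andP[-> /ltnW ->] := h r pr rn.
  have /andP[Tr] := h r pr rn; rewrite leq_eqVlt => /orP[/eqP e|->].
    by rewrite e pr Tr in nq.
  by rewrite Tr.
have := zeta_onID s1 V [set n | (q %| n)%N].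
have -> : V `&` [set n | (q %| n)%N] = [set (q * n)%N | n in V].
  apply/seteqP; split=> [n [[n0 h] /= /dvdnP[m nm]]|_ [n [n0 h] <-]].
    exists m; last by rewrite mulnC.
    split; first by move: n0; rewrite nm muln_gt0 => /andP[].
    by move=> r pr rm; apply: h => //; rewrite nm dvdn_mulr.
  split; last by rewrite /= dvdn_mulr.
  split; first by rewrite muln_gt0 prime_gt0.
  move=> r pr; rewrite Euclid_dvdM// => /orP[|/(h _ pr)//].
  by rewrite dvdn_prime2// => /eqP ->; rewrite Tq leqnn.
rewrite (zeta_on_dilate s1) ?prime_gt0//.
have -> : V `&` ~` [set n | (q %| n)%N] = U; last by move=> e; rewrite mulrBr mulr1 {1}e; ring.
apply/seteqP; split=> n.
  move=> [[n0 h] /= /negP qn]; split=> // r pr rn.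
  have /andP[-> /=] := h r pr rn; rewrite leq_eqVlt => /orP[/eqP e|//].
  by rewrite e rn in qn.
move=> [n0 h]; split.
  by split=> // r pr rn; have /andP[-> /ltnW] := h r pr rn.
by move=> /(h _ pq); rewrite ltnn andbF.
Qed.

Lemma zeta_on_smooth_ge1 (R : realType) (s : R) (T : pred nat) : 1 < s ->
  1 <= zeta_on s (smooth_set T).
Proof.
move=> s1; rewrite -lee_fin -(esum_zetaE s1).
have := @le_esum_nat R (smooth_set T) (zeta_weight s) [:: 1%N] isT.
rewrite big_seq1 /zeta_weight powR1; apply => n.
rewrite inE => /eqP ->; split=> // r pr; rewrite dvdn1 => /eqP e.
by rewrite e in pr.
Qed.

Lemma zeta_weight_lt1 (R : realType) (s : R) (n : nat) : 1 < s -> (1 < n)%N ->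
  zeta_weight s n <= n%:R^-1.
Proof.
move=> s1 n1; rewrite -(powR_inv1 (ler0n R n)) ler_powR ?ler1n ?(ltnW n1)//.
by rewrite lerN2 ltW.
Qed.

Lemma euler_product_le (R : realType) (s : R) (N : nat) : 1 < s ->
  \sum_(0 <= p < N | prime p) - ln (1 - zeta_weight s p) <= ln (1 + (s - 1)^-1).
Proof.
move=> s1; have s0 : 0 < s - 1 by rewrite subr_gt0.
have pos p : prime p -> 0 < 1 - zeta_weight s p.
  move=> pp; have := zeta_weight_lt1 s1 (prime_gt1 pp).
  by have /andP[_] := prime_inv_bounds R pp; lra.
set P := \prod_(0 <= r < N | prime r && predT r) (1 - zeta_weight s r).
have P0 : 0 < P by apply: prodr_gt0 => p /andP[pp _]; exact: pos.
have -> : \sum_(0 <= p < N | prime p) - ln (1 - zeta_weight s p) = - ln P.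
  rewrite /P; under [in RHS]eq_bigl do rewrite andbT.
  elim: N {P P0} => [|q IH]; first by rewrite !big_geq// ln1 oppr0.
  rewrite big_mkcond [in RHS]big_mkcond/= !big_nat_recr//=.
  rewrite -!big_mkcond/= IH; case: ifP => pq; last by rewrite mulr1 addr0.
  rewrite lnM ?posrE ?opprD//; last exact: pos.
  by apply: prodr_gt0 => p pp; exact: pos.
rewrite -lnV ?posrE// ler_ln ?posrE ?invr_gt0 ?addr_gt0 ?invr_gt0//.
have := @zeta_on_smooth_ge1 R s (fun r => predT r && (N <= r)%N) s1.
rewrite zeta_rough// -/P => h; rewrite -[P^-1]mul1r ler_pdivrMr//.
by apply: le_trans h _; rewrite ler_wpM2r ?(ltW P0)// zeta_on_le.
Qed.

Lemma sum_zeta_on_le (R : realType) (s : R) (B : seq nat) (L : nat -> set nat)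
    (S : set nat) : 1 < s -> uniq B ->
  (forall a, a \in B -> L a `<=` S) ->
  (forall a b, a \in B -> b \in B -> a != b -> L a `&` L b = set0) ->
  \sum_(a <- B) zeta_on s (L a) <= zeta_on s S.
Proof.
move=> s1; elim: B S => [|b B IH] S /=; first by rewrite big_nil zeta_on_ge0.
move=> /andP[bB uB] LS dis; rewrite big_cons (zeta_onID s1 S (L b)).
have -> : S `&` L b = L b by apply/setIidr; apply: LS; rewrite mem_head.
rewrite lerD2l IH//.
  move=> a aB n Lan; split; first by apply: (LS a) => //; rewrite in_cons aB orbT.
  move=> Lbn; have : (L a `&` L b) n by [].
  rewrite dis ?mem_head ?in_cons ?aB ?orbT//.
  by apply: contraNneq bB => <-.
by move=> a c aB cB; apply: dis; rewrite in_cons ?aB ?cB orbT.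
Qed.

Definition mult_set (T : pred nat) (a : nat) : set nat :=
  [set (a * m)%N | m in smooth_set (fun r => T r && (max_pdiv a <= r)%N)].

Lemma coprime_rough (T : pred nat) (a m : nat) (q : nat) : (0 < a)%N ->
  (forall r, prime r -> (r %| a)%N -> (r < q)%N) ->
  smooth_set (fun r => T r && (q <= r)%N) m -> coprime a m.
Proof.
move=> a0 aq [m0 mq]; apply/negPn/negP => /eqP/eqP cp.
have g1 : (1 < gcdn a m)%N.
  by rewrite ltn_neqAle eq_sym cp gcdn_gt0 a0.
have pp := pdiv_prime g1; have pg := pdiv_dvd (gcdn a m).
have pa : (pdiv (gcdn a m) %| a)%N by apply: dvdn_trans pg (dvdn_gcdl _ _).
have pm : (pdiv (gcdn a m) %| m)%N by apply: dvdn_trans pg (dvdn_gcdr _ _).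
have := aq _ pp pa; have /andP[_] := mq _ pp pm.
by rewrite leqNgt => /negP.
Qed.

Lemma mult_set_disjoint (T : pred nat) (a b : nat) : (1 < a)%N -> (1 < b)%N ->
  ~~ (a %| b)%N -> ~~ (b %| a)%N -> mult_set T a `&` mult_set T b = set0.
Proof.
wlog ab : a b / (max_pdiv a <= max_pdiv b)%N.
  move=> H a1 b1 nab nba; case: (leqP (max_pdiv a) (max_pdiv b)) => [|/ltnW] h.
    exact: H.
  by rewrite setIC; exact: H.
move=> a1 b1 nab nba; apply/seteqP; split=> // n [[m hm e] [m' hm' e']].
have a0 := ltnW a1; have b0 := ltnW b1.
have max_le c r : (0 < c)%N -> prime r -> (r %| c)%N -> (r <= max_pdiv c)%N.
  by move=> c0 pr rc; apply: max_pdiv_max; rewrite mem_primes pr c0.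
have abm : (a %| b * m')%N by rewrite e' -e dvdn_mulr.
move: ab; rewrite leq_eqVlt => /orP[/eqP eab|ltab]; last first.
  have cop : coprime a m'.
    apply: (@coprime_rough T _ _ (max_pdiv b)) => // r pr ra.
    by apply: leq_ltn_trans ltab; exact: max_le.
  by move: nab; rewrite -(Gauss_dvdl _ cop) abm.
set q := max_pdiv a in eab; have pq : prime q by exact: max_pdiv_prime.
rewrite -/q in hm; rewrite -eab in hm'.
have [c qc ea] := pfactor_coprime pq a0.
have [d qd eb] := pfactor_coprime pq b0.
move: ea eb; set i := logn q a; set j := logn q b => ea eb.
have small x y k : (0 < y)%N -> y = (x * q ^ k)%N -> coprime q x ->
    (max_pdiv y = q) -> forall r, prime r -> (r %| x)%N -> (r < q)%N.
  move=> y0 ey qx qy r pr rx; rewrite ltn_neqAle -{2}qy max_le ?andbT//; last first.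
    by rewrite ey dvdn_mulr.
  by apply: contraTneq qx => <-; rewrite prime_coprime// negbK.
have c0 : (0 < c)%N by move: a0; rewrite ea muln_gt0 => /andP[].
have d0 : (0 < d)%N by move: b0; rewrite eb muln_gt0 => /andP[].
have dvdxy (x y u v : nat) k l : (0 < x)%N ->
    (forall r, prime r -> (r %| x)%N -> (r < q)%N) -> coprime q x ->
    smooth_set (fun r => T r && (q <= r)%N) v ->
    (x * q ^ k * u = y * q ^ l * v)%N -> (x %| y)%N.
  move=> x0 xq qx hv e2.
  have cv : coprime x v := coprime_rough x0 xq hv.
  have cq : coprime x (q ^ l) by rewrite coprimeXr// coprime_sym.
  have : (x %| y * q ^ l * v)%N by rewrite -e2 -mulnA dvdn_mulr.
  by rewrite (Gauss_dvdl _ cv) (Gauss_dvdl _ cq).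
have cd : (c %| d)%N.
  apply: (@dvdxy c d m m' i j) => //; first exact: (small c a i).
  by rewrite -ea -eb e e'.
have dc : (d %| c)%N.
  apply: (@dvdxy d c m' m j i) => //; first by apply: (small d b j).
  by rewrite -ea -eb e e'.
have ecd : c = d by apply/eqP; rewrite eqn_dvd cd dc.
case: (leqP i j) => [ij|/ltnW ji].
  by move: nab; rewrite ea eb ecd dvdn_pmul2l// dvdn_exp2l.
by move: nba; rewrite ea eb ecd dvdn_pmul2l// dvdn_exp2l.
Qed.

Lemma le_of_forall_sub (R : realType) (X Y Z : R) : 0 <= Y ->
  (forall e, 0 < e -> X - e * Y <= Z) -> X <= Z.
Proof.
move=> Y0 H; apply/ler_addgt0Pl => e e0.
have Y1 : 0 < Y + 1 by rewrite ltr_wpDl.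
have := H (e / (Y + 1)) (divr_gt0 e0 Y1).
have : e / (Y + 1) * Y <= e.
  by rewrite mulrAC ler_pdivrMr// ler_wpM2l ?(ltW e0)// lerDl.
lra.
Qed.

Lemma primitive_density (R : realType) (T : pred nat) (d : nat) (B : seq nat) :
  (0 < d)%N -> uniq B ->
  (forall a, a \in B -> (1 < a)%N) ->
  (forall a b, a \in B -> b \in B -> (a %| b)%N -> a = b) ->
  (forall a, a \in B -> (d %| a)%N) ->
  (forall a, a \in B -> smooth_set T a) ->
  \sum_(a <- B) a%:R^-1 *
    \prod_(0 <= r < max_pdiv a | prime r && T r) (1 - r%:R^-1) <= d%:R^-1 :> R.
Proof.
move=> d0 uB B1 prim dB TB.
pose f a : R := a%:R^-1 *
    \prod_(0 <= r < max_pdiv a | prime r && T r) (1 - r%:R^-1).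
have f0 a : 0 <= f a.
  rewrite mulr_ge0 ?invr_ge0// prodr_ge0// => r /andP[pr _].
  by have /andP[_] := prime_inv_bounds R pr; lra.
pose Y := \sum_(a <- B) ln a%:R * f a.
have Y0 : 0 <= Y.
  rewrite /Y big_seq; apply: sumr_ge0 => a aB; rewrite mulr_ge0// ln_ge0//.
  by rewrite ler1n ltnW// B1.
apply: (le_of_forall_sub Y0) => e e0.
pose s := 1 + e; have s1 : 1 < s by rewrite /s ltrDl.
pose zT := zeta_on s (smooth_set T).
have zT0 : 0 < zT by apply: lt_le_trans (zeta_on_smooth_ge1 T s1).
have main : \sum_(a <- B) zeta_on s (mult_set T a) <= zeta_weight s d * zT.
  rewrite -(zeta_on_dilate s1)//; apply: sum_zeta_on_le => //.
    move=> a aB _ [m [m0 hm] <-]; have /dvdnP[a' ea] := dB _ aB.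
    exists (a' * m)%N; last by rewrite ea; ring.
    have [a0 ha] := TB _ aB.
    split; first by move: a0; rewrite ea !muln_gt0 m0 => /andP[->].
    move=> r pr; rewrite Euclid_dvdM// => /orP[ra'|/(hm _ pr)/andP[]//].
    by apply: ha => //; rewrite ea dvdn_mulr.
  move=> a b aB bB ab; apply: mult_set_disjoint; rewrite ?B1//.
    by apply: contraNN ab => /(prim _ _ aB bB)/eqP.
  by apply: contraNN ab => /(prim _ _ bB aB) ->.
have fe : \sum_(a <- B) f a - e * Y <= zeta_weight s d.
  rewrite -(ler_pM2r zT0); apply: le_trans main.
  rewrite /Y mulr_sumr -sumrB mulr_suml big_seq [leRHS]big_seq.
  apply: ler_sum => a aB.
  have a0 : (0 < a)%N by rewrite ltnW// B1.
  have a0' : 0 < a%:R :> R by rewrite ltr0n.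
  rewrite /mult_set (zeta_on_dilate s1)// zeta_rough// [leRHS]mulrCA [leRHS]mulrC.
  rewrite ler_wpM2r ?(ltW zT0)//.
  have -> : zeta_weight s a = a%:R^-1 * expR (- (e * ln a%:R)).
    rewrite /zeta_weight /powR gt_eqF// /s -{2}(lnK a0') -expRN -expRD.
    by congr expR; ring.
  have := expR_ge1Dx (- (e * ln a%:R)); have := expR_ge0 (- (e * ln a%:R)).
  move: (expR _) => E E0 hE.
  apply: (@le_trans _ _ (f a * E)).
    by move: (f0 a) hE; move: (f a) (ln _) => F l; nra.
  rewrite /f mulrAC ler_wpM2l ?mulr_ge0 ?invr_ge0//.
  apply: ler_prod => r /andP[pr _].
  have /andP[_ h] := prime_inv_bounds R pr.
  have := zeta_weight_lt1 s1 (prime_gt1 pr); lra.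
apply: le_trans fe _; have [d1|] := ltnP 1 d; first exact: zeta_weight_lt1.
by case: d d0 {dB main} => [//|[|//]] _ _; rewrite /zeta_weight powR1 invr1.
Qed.

(** * Comparison of the constant with Euler's constant *)

Lemma harmonic_bounds (R : realType) (N : nat) :
  series (@harmonic R) N.+1 - ln N.+2%:R <= euler_gamma R /\
  ((1 < N)%N -> euler_gamma R <= series (@harmonic R) N.+1 - ln (N%:R + 3 / 2)).
Proof.
pose H := series (@harmonic R).
pose u n : R := H n.+1 - ln n.+1%:R.
pose v n : R := H n.+1 - ln n.+2%:R.
pose t n : R := H n.+1 - ln (n%:R + 3 / 2).
have HS n : H n.+1 = H n + n.+1%:R^-1 by rewrite /H seriesEnat/= big_nat_recr.
have lnS n : n.+2%:R^-1 <= ln n.+2%:R - ln n.+1%:R :> R /\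
    ln n.+2%:R - ln n.+1%:R <= n.+1%:R^-1 :> R.
  have [h1 h2] := @ln_succ_bounds R n.+1 isT.
  split; first by rewrite -[n.+2%:R^-1]div1r ler_pdivrMr// mulrC.
  by rewrite -[n.+1%:R^-1]div1r ler_pdivlMr// mulrC.
have v_inc : {homo v : n m / (n <= m)%N >-> n <= m}.
  apply: homo_leq => // [|n]; first exact: le_trans.
  rewrite /v [H n.+2]HS; have [_] := lnS n.+1.
  move: (H n.+1) (ln _) (ln _) (_^-1) => a b c d; lra.
have u_dec : {homo u : n m / (n <= m)%N >-> m <= n}.
  apply: (@homo_leq _ u (fun a b => b <= a)) => // [a b c h1 h2|n].
    exact: le_trans h2 h1.
  rewrite /u [H n.+2]HS; have [+ _] := lnS n.
  by move: (H n.+1) (ln _) (ln _) (_^-1) => a b c d; lra.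
have vu n : v n <= u n.
  by rewrite /v /u lerD2l lerN2 ler_ln ?posrE// ler_nat.
have t_dec : forall n m, (1 < n)%N -> (n <= m)%N -> t m <= t n.
  move=> n m n1; elim: m => [|m IH]; first by rewrite leqn0 => /eqP ->.
  rewrite leq_eqVlt => /orP[/eqP ->//|nm]; apply: le_trans (IH nm).
  have m2 : 2 <= m%:R :> R by rewrite ler_nat (leq_trans n1).
  pose x : R := (m%:R + 3 / 2)^-1.
  have mp : 0 < m%:R + 3 / 2 :> R by lra.
  have x0 : 0 < x by rewrite invr_gt0.
  have x2 : x <= 2^-1 by rewrite lef_pV2 ?posrE//; lra.
  have e1 : m.+1%:R + 3 / 2 = (m%:R + 3 / 2) * (1 + x) :> R.
    rewrite mulrDr mulr1 divff ?gt_eqF// -natr1; lra.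
  have e2 : m.+2%:R^-1 = 2 * x / (2 + x) :> R.
    by rewrite /x -!natr1; field; rewrite !gt_eqF//; lra.
  have xp : 0 < 1 + x by rewrite addr_gt0.
  rewrite /t [H m.+2]HS e1 lnM ?posrE// e2.
  suff : 2 * x / (2 + x) <= ln (1 + x).
    by move=> h; rewrite -addrA lerD2l opprD addrCA gerDl subr_le0.
  apply: le_trans (ln1D_ge (ltW x0)); rewrite ler_pdivrMr ?addr_gt0//.
  rewrite -subr_ge0 (_ : _ - _ = x ^+ 3 * (1 / 6 - x / 6 - x ^+ 2 / 4)); last by field.
  by rewrite mulr_ge0 ?exprn_ge0 ?(ltW x0)//; nra.
have u_cvg : cvgn u.
  apply: nonincreasing_is_cvgn => //; exists (v 0%N) => _ [n _ <-].
  by apply: le_trans (vu n); exact: v_inc.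
have -> : euler_gamma R = limn u by [].
split.
  apply: limr_ge => //; exists N => // n /= Nn.
  by apply: le_trans (vu n); exact: v_inc.
move=> N1; apply/ler_addgt0Pl => e e0.
apply: limr_le => //.
have [K Ke] : exists K : nat, e^-1 < K%:R.
  by exists (Num.truncn e^-1).+1; exact: truncnS_gt.
exists (maxn N K) => // n /= hn.
have Nn : (N <= n)%N by apply: leq_trans hn; exact: leq_maxl.
have Kn : (K <= n)%N by apply: leq_trans hn; exact: leq_maxr.
have := t_dec _ _ N1 Nn; rewrite /t -/(H N.+1) => tt.
have n0 : 0 < n.+1%:R :> R by [].
have n3 : 0 < n%:R + 3 / 2 :> R by rewrite ltr_wpDl//; lra.
have := ln_tangent n0 n3.
have -> : n%:R + 3 / 2 = n.+1%:R + 1 / 2 :> R by rewrite -natr1; lra.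
rewrite mulrDl divff ?gt_eqF// => hl.
have he : 1 / 2 / n.+1%:R <= e.
  have ne : e^-1 < n.+1%:R by apply: lt_le_trans Ke _; rewrite ler_nat leqW.
  rewrite ler_pdivrMr//; have : 1 < e * n.+1%:R by rewrite -ltr_pdivrMl ?mulr1.
  lra.
move: tt; rewrite /u -/(H N.+1).
have -> : n%:R + 3 / 2 = n.+1%:R + 1 / 2 :> R by rewrite -natr1; lra.
move: hl he; move: (H n.+1) (H N.+1) (1 / 2 / n.+1%:R) => a b c.
move: (ln _) (ln _) (ln _) => d f g; lra.
Qed.

Lemma abel_lower (R : realType) (D : nat -> R) (y delta C : R) (K : nat) :
  0 <= y < 1 -> 0 <= C -> D 0%N = 0 -> (0 < K)%N ->
  (forall k, (0 < k)%N -> delta - C / k%:R <= D k) ->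
  delta * y - C * (K%:R^-1 + (1 - y) * \sum_(k < K) y ^+ k.+1 / k.+1%:R)
  <= \sum_(k < K) y ^+ k.+1 * (D k.+1 - D k).
Proof.
move=> /andP[y0 y1] C0 D0 K0 hD.
have -> : \sum_(k < K) y ^+ k.+1 * (D k.+1 - D k) =
    y ^+ K.+1 * D K + (1 - y) * \sum_(k < K) y ^+ k.+1 * D k.+1.
  elim: K {K0} => [|K IH]; first by rewrite !big_ord0 D0; ring.
  by rewrite !big_ord_recr/= IH [y ^+ K.+2]exprS; ring.
have geo : y = y ^+ K.+1 + (1 - y) * \sum_(k < K) y ^+ k.+1.
  elim: K {K0} => [|K IH]; first by rewrite big_ord0; ring.
  by rewrite big_ord_recr/= {1}IH [y ^+ K.+2]exprS; ring.
have yK : 0 <= y ^+ K.+1 <= 1 by rewrite exprn_ge0// exprn_ile1// ltW.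
have h1 : y ^+ K.+1 * (delta - C / K%:R) <= y ^+ K.+1 * D K.
  by rewrite ler_wpM2l ?hD//; case/andP: yK.
have h2 : \sum_(k < K) y ^+ k.+1 * (delta - C / k.+1%:R) <=
    \sum_(k < K) y ^+ k.+1 * D k.+1.
  by apply: ler_sum => k _; rewrite ler_wpM2l ?exprn_ge0// hD.
have h3 : \sum_(k < K) y ^+ k.+1 * (delta - C / k.+1%:R) =
    delta * \sum_(k < K) y ^+ k.+1 - C * \sum_(k < K) y ^+ k.+1 / k.+1%:R.
  by rewrite !mulr_sumr -sumrB; apply: eq_bigr => k _; ring.
move: h2; rewrite h3 => h2.
have y1' : 0 <= 1 - y by lra.
have := ler_wpM2l y1' h2 => {}h2.
have h4 : y ^+ K.+1 * (C / K%:R) <= C / K%:R.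
  by rewrite ler_piMl ?divr_ge0//; case/andP: yK.
rewrite {1}geo.
move: h1 h2 h4; move: (\sum_(k < K) _) (\sum_(k < K) _) (\sum_(k < K) _) => a b d.
move: (D K) (y ^+ K.+1) (K%:R^-1) => p q i; lra.
Qed.

Lemma shifted_ln_term (R : realType) (x v : R) : 0 < x <= 2^-1 -> 0 <= v <= 1 ->
  v * - ln (1 - x) <= - ln (1 - x * v) + (1 - v) * (x ^+ 2 / (1 - x)).
Proof.
move=> /andP[x0 x2] /andP[v0 v1].
have p1 : 0 < 1 - x by lra.
have p2 : 0 < 1 - x * v by nra.
have t := ln_tangent p1 p2.
have g : x <= - ln (1 - x).
  by have := ln_tangent (@ltr01 R) p1; rewrite ln1; lra.
have e1 : (1 - x * v) / (1 - x) - 1 = (1 - v) * (x / (1 - x)).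
  by field; rewrite gt_eqF.
have e2 : x / (1 - x) - x = x ^+ 2 / (1 - x) by field; rewrite gt_eqF.
rewrite -e2; move: t g; rewrite -addrA e1.
move: (ln _) (ln _) (x / _) => a b q; nra.
Qed.

Lemma prime_tail_le (R : realType) (a N : nat) : (0 < a)%N ->
  \sum_(0 <= p < N | prime p && (a < p)%N) (p.-1%:R^-1 - p%:R^-1) <= a%:R^-1 :> R.
Proof.
move=> a0; have a0' : 0 <= a%:R^-1 :> R by rewrite invr_ge0.
apply: (@le_trans _ _ (\sum_(a.+1 <= p < N) (p.-1%:R^-1 - p%:R^-1))).
  rewrite [leRHS](big_nat_widenl _ 0%N)// [leLHS]big_mkcond [leRHS]big_mkcond/=.
  apply: ler_sum => p _; case: (ltnP a p) => [ap|]; rewrite ?andbF// andbT.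
  case: ifP => // _; rewrite subr_ge0.
  case: p ap => [//|[|p]] ap /=; first by rewrite ltnS leqNgt a0 in ap.
  by rewrite lef_pV2 ?posrE// ler_nat.
have [aN|aN] := leqP a.+1 N; last by rewrite big_geq// ltnW.
rewrite (eq_bigr (fun p => - p.+1.-1%:R^-1 - - p.-1%:R^-1)); last first.
  by move=> p _; rewrite opprK addrC.
rewrite (@telescope_sumr _ _ _ (fun p => - p.-1%:R^-1))//= opprK addrC.
by rewrite gerBl invr_ge0.
Qed.

Lemma prime_series_le (R : realType) (e : R) (j N : nat) : 0 < e -> (0 < j)%N ->
  \sum_(0 <= p < N | prime p) - ln (1 - p%:R^-1) * expR (- (e * ln p%:R)) <=
  ln (1 + e^-1) + e * j%:R + j%:R^-1.
Proof.
move=> e0 j0; have s1 : 1 < 1 + e by rewrite ltrDl.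
have j0' : 0 <= j%:R :> R by [].
have := euler_product_le N s1; rewrite addrAC subrr add0r => hE.
pose tau p : R := p.-1%:R^-1 - p%:R^-1.
have hp p : prime p -> - ln (1 - p%:R^-1) * expR (- (e * ln p%:R)) <=
    - ln (1 - zeta_weight (1 + e) p) + (e * j%:R * tau p +
      if (j < p)%N then tau p else 0).
  move=> pp; have hx := prime_inv_bounds R pp.
  have p0 : 0 < p%:R :> R by rewrite ltr0n prime_gt0.
  have p1 : 0 < p.-1%:R :> R by rewrite ltr0n -subn1 subn_gt0 prime_gt1.
  have lp : 0 <= ln p%:R :> R by rewrite ln_ge0// ler1n prime_gt0.
  set v := expR _; have hv : 0 <= v <= 1.
    by rewrite expR_ge0 expR_le1 oppr_le0 mulr_ge0// ltW.
  have -> : zeta_weight (1 + e) p = p%:R^-1 * v.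
    rewrite /zeta_weight /powR gt_eqF// -{2}(lnK p0) -expRN -expRD.
    by congr expR; ring.
  rewrite mulrC; apply: le_trans (shifted_ln_term hx hv) _.
  rewrite lerD2l.
  have -> : p%:R^-1 ^+ 2 / (1 - p%:R^-1) = tau p.
    have ep : p%:R = p.-1%:R + 1 :> R by rewrite natr1 prednK// prime_gt0.
    by rewrite /tau ep; field; rewrite ?addrK -?ep !gt_eqF.
  have t0 : 0 <= tau p.
    by rewrite subr_ge0 lef_pV2 ?posrE// ler_nat leq_pred.
  have v1 : 1 - v <= e * ln p%:R.
    by have := expR_ge1Dx (- (e * ln p%:R)); rewrite -/v; lra.
  case: ltnP => [jp|pj].
    have := mulr_ge0 (mulr_ge0 (ltW e0) j0') t0.
    by case/andP: hv => *; nra.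
  rewrite addr0 ler_wpM2r//; apply: le_trans v1 _; rewrite ler_wpM2l ?(ltW e0)//.
  apply: le_trans (ltW (ln_sublinear p0)) _; by rewrite ler_nat.
apply: le_trans (ler_sum _ hp) _.
rewrite big_split big_split/= -addrA lerD// lerD//.
  rewrite -mulr_sumr ler_piMr ?mulr_ge0 ?(ltW e0)//.
  have := @prime_tail_le R 1 N isT; rewrite invr1; apply: le_trans.
  rewrite le_eqVlt; apply/orP; left; apply/eqP; apply: eq_bigl => p.
  by case: (boolP (prime p)) => // /prime_gt1 ->.
by rewrite -big_mkcondr; exact: prime_tail_le.
Qed.

Definition exp_floor (R : realType) (k : nat) : nat := Num.truncn (expR (k%:R : R)).

Lemma exp_floorP (R : realType) (k n : nat) :
  (n <= exp_floor R k)%N = (n%:R <= expR (k%:R : R)).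
Proof. by rewrite /exp_floor truncn_ge_nat// expR_ge0. Qed.

(* Primes in the block from [expR k] to [expR k.+1] are given the weight of the
   right end of the block. *)
Lemma block_lower (R : realType) (e : R) (K : nat) : 0 < e ->
  \sum_(k < K) expR (- e) ^+ k.+1 *
    (- ln (mertens_product R (exp_floor R k.+1).+1)
     - - ln (mertens_product R (exp_floor R k).+1))
  <= \sum_(0 <= p < (exp_floor R K).+1 | prime p)
       - ln (1 - p%:R^-1) * expR (- (e * ln p%:R)).
Proof.
move=> e0.
have g0 p : prime p -> 0 <= - ln (1 - p%:R^-1) :> R.
  by move=> pp; rewrite oppr_ge0 ln_le0// gerBl.
elim: K => [|K IH].
  by rewrite big_ord0; apply: sumr_ge0 => p pp; rewrite mulr_ge0 ?expR_ge0 ?g0.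
have NK : (exp_floor R K <= exp_floor R K.+1)%N.
  rewrite exp_floorP; apply: le_trans (_ : expR K%:R <= _).
    by rewrite -exp_floorP.
  by rewrite ler_expR ler_nat.
rewrite big_ord_recr/= (@big_cat_nat _ _ _ (exp_floor R K).+1)//=; apply: lerD => //.
have -> : - ln (mertens_product R (exp_floor R K.+1).+1)
     - - ln (mertens_product R (exp_floor R K).+1) =
    \sum_((exp_floor R K).+1 <= p < (exp_floor R K.+1).+1 | prime p) - ln (1 - p%:R^-1).
  rewrite !ln_mertens_product.
  by rewrite (@big_cat_nat _ _ _ (exp_floor R K).+1 _ (exp_floor R K.+1).+1)//= addrAC subrr add0r.
rewrite mulr_sumr [leLHS]big_nat_cond [leRHS]big_nat_cond; apply: ler_sum => p.
move=> /andP[/andP[_ pN] pp]; rewrite mulrC ler_wpM2l ?g0//.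
have p0 : 0 < p%:R :> R by rewrite ltr0n prime_gt0.
rewrite -expRM_natl ler_expR mulrN lerN2 mulrC ler_wpM2r ?(ltW e0)//.
rewrite -[leRHS]expRK ler_ln ?posrE ?expR_gt0//.
by rewrite -exp_floorP.
Qed.

Definition mertens_const (R : realType) (c : R) :=
  forall N, (100 ^ 2 <= N)%N -> `|mangoldt_defect R N - c| <= osc_bound R N.

Lemma osc_bound_le (R : realType) (N k : nat) : (1 < k <= N)%N ->
  k%:R - 1 <= ln N%:R :> R -> osc_bound R N <= 2 * (k%:R - 1)^-1.
Proof.
move=> /andP[k1 kN] hl.
have kp : 0 < k%:R - 1 :> R by rewrite subr_gt0 ltr1n.
have l0 : 0 < ln N%:R :> R by exact: lt_le_trans kp hl.
rewrite /osc_bound [leRHS]mulr_natl [leRHS]mulr2n; apply: lerD.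
  apply: (@le_trans _ _ (1 / ln N%:R)).
    have i0 : 0 <= (ln N%:R)^-1 :> R by rewrite invr_ge0 ltW.
    have h : 881 / 1000 <= 1 :> R by lra.
    exact: ler_wpM2r i0 _ _ h.
  by rewrite div1r lef_pV2 ?posrE.
have -> : k%:R - 1 = k.-1%:R :> R by rewrite -subn1 natrB// ltnW.
rewrite lef_pV2 ?posrE ?ltr0n -?subn1 ?subn_gt0 ?ler_nat ?leq_sub2r//.
exact: leq_trans kN.
Qed.

Lemma block_defect_ge (R : realType) (c : R) : mertens_const c ->
  exists2 C : R, 0 <= C & forall k, (0 < k)%N ->
    c - euler_gamma R - C / k%:R <=
    - ln (mertens_product R (exp_floor R k).+1) - series (@harmonic R) k.
Proof.
move=> hc; set d := c - euler_gamma R.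
exists (100 + 10 * `|d|) => [|k k0]; first by rewrite addr_ge0// mulr_ge0.
have k0' : 0 < k%:R :> R by rewrite ltr0n.
have d1 : d <= `|d| := ler_norm d.
have d2 : 0 <= `|d| := normr_ge0 d.
have [k9|k9] := leqP k 9.
  have hH : series (@harmonic R) k <= 9.
    apply: (@le_trans _ _ k%:R); last by rewrite ler_nat.
    rewrite seriesEnat/= (_ : k%:R = \sum_(0 <= i < k) 1).
      by apply: ler_sum => i _; rewrite invf_le1// ler1n.
    by rewrite sumr_const_nat subn0.
  have hG : 0 <= - ln (mertens_product R (exp_floor R k).+1).
    rewrite ln_mertens_product; apply: sumr_ge0 => p pp.
    by rewrite oppr_ge0 ln_le0// gerBl.
  have : 100 + 10 * `|d| <= (100 + 10 * `|d|) / k%:R * 9.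
    rewrite mulrAC ler_pdivlMr// ler_wpM2l ?ler_nat// addr_ge0// mulr_ge0//.
  move: hH hG; move: (series _ _) (- ln _) (_ / _) => H G q; lra.
set N := exp_floor R k.
have hN : (100 ^ 2 <= N)%N.
  rewrite /N exp_floorP -[leLHS](@lnK R) ?posrE ?ltr0n// ler_expR ln_10000.
  have [/andP[_ b2] _ /andP[_ b5]] := ln235_bounds R.
  have : 10 <= k%:R :> R by rewrite ler_nat.
  by move: (ln 2) (ln 5) b2 b5 => a b; lra.
have k1 : 9 <= k%:R - 1 :> R.
  by have : 10 <= k%:R :> R by [rewrite ler_nat]; lra.
have kp : 0 < k%:R - 1 :> R by lra.
have N0 : 0 < N%:R :> R by rewrite ltr0n (leq_trans _ hN).
have kN : (k <= N)%N.
  by rewrite /N exp_floorP; apply: le_trans (expR_ge1Dx _); lra.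
have lN : k%:R - 1 <= ln N%:R :> R.
  rewrite -[leLHS]expRK ler_ln ?posrE ?expR_gt0//.
  have hlt : expR k%:R < N%:R + 1 :> R.
    by rewrite natr1 ltNge -exp_floorP ltnn.
  have e1 : expR k%:R = expR 1 * expR (k%:R - 1) :> R.
    by rewrite -expRD; congr expR; ring.
  have e2 : 2 <= expR 1 :> R by have := expR_ge1Dx (1 : R); lra.
  have e3 : 1 <= expR (k%:R - 1) :> R by have := expR_ge1Dx (k%:R - 1 : R); lra.
  by move: hlt; rewrite e1; nra.
move: hN N0 kN lN; move: N => N hN N0 kN lN.
have lN0 : 0 < ln N%:R :> R by lra.
have llN : ln k%:R - (k%:R - 1)^-1 <= ln (ln N%:R) :> R.
  have h1 : ln (k%:R - 1) <= ln (ln N%:R) :> R by rewrite ler_ln ?posrE.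
  have := ln_tangent kp k0'.
  have -> : k%:R / (k%:R - 1) = 1 + (k%:R - 1)^-1 :> R.
    by field; rewrite gt_eqF.
  lra.
have kinv : (k%:R - 1)^-1 <= 2 / k%:R :> R.
  by rewrite ler_pdivlMr// mulrC ler_pdivrMr//; lra.
have hosc : osc_bound R N <= 2 * (k%:R - 1)^-1.
  by apply: osc_bound_le => //; rewrite kN andbT; exact: leq_trans k9.
have := hc N hN; rewrite ler_distl => /andP[hl _].
have hL := mangoldt_sum_le R N.
have hH : series (@harmonic R) k <= euler_gamma R + ln k%:R + k%:R^-1.
  have [+ _] := harmonic_bounds R k.-1; rewrite prednK//.
  have := ln_tangent k0' (ltr0Sn R k).
  have -> : k.+1%:R / k%:R = 1 + k%:R^-1 :> R.
    by rewrite -natr1; field; rewrite gt_eqF.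
  move: (series _ _) => H; lra.
have k7 : 7 / k%:R <= (100 + 10 * `|d|) / k%:R.
  by rewrite ler_wpM2r ?invr_ge0//; lra.
have kk : 7 / k%:R = 7 * k%:R^-1 :> R by [].
move: hl; rewrite /mangoldt_defect => hl.
move: hl hosc hL hH llN k7 kinv; rewrite kk /d.
move: (series _ _) (osc_bound _ _) (mangoldt_sum _ _) (ln (mertens_product _ _)).
move: (ln (ln _)) (ln k%:R) (k%:R^-1) ((k%:R - 1)^-1) (`|_|) => x1 x2 i m n H w L G.
lra.
Qed.

(* Were [d = c - gamma] positive, then by partial summation the blockwise
   weighted sum of [- ln (1 - 1/p)] would exceed [\sum_k y ^+ k / k], about
   [ln (1 / e)], by about [d]; but the bound [1 + 1/e] on zeta at [1 + e] limits
   it to [ln (1 / e) + o(1)].  Here [e] is about [J ^- 2], with [J] large. *)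
Lemma mertens_const_le_gamma (R : realType) (c : R) :
  mertens_const c -> c <= euler_gamma R.
Proof.
move=> hc; have [C C0 hC] := block_defect_ge hc.
set d := c - euler_gamma R in hC.
have key (j : nat) : (1 < j)%N -> d * j%:R <= 2 * (5 + 3 * C) \/ d <= 0.
  move=> j1; have [d0|/ltW d0] := leP d 0; [by right|left].
  have j0 : (0 < j)%N by exact: ltnW.
  have J2 : 2 <= j%:R :> R by rewrite ler_nat.
  have J0 : 0 < j%:R :> R by lra.
  set J := j%:R in J2 J0 *.
  pose u := J ^- 2.
  have u0 : 0 < u by rewrite invr_gt0 exprn_gt0.
  have JJ : 4 <= J ^+ 2 by nra.
  have u4 : u <= 1 / 4 by rewrite div1r lef_pV2 ?posrE ?exprn_gt0.
  pose y := 1 - u.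
  have y01 : 0 <= y < 1 by rewrite /y; apply/andP; split; lra.
  pose e := - ln y.
  have ye : y = expR (- e) by rewrite /e opprK lnK// posrE /y; lra.
  have u01 : 0 <= u < 1 by apply/andP; split; lra.
  have e_lo : u <= e.
    have := ln_series 1 u01; rewrite big_ord1 expr1 divr1 => /andP[].
    by rewrite -/y -/e.
  have e_hi : e <= 2 * u.
    have := ln_series 0 u01; rewrite big_ord0 add0r expr1 mul1r => /andP[_].
    rewrite -/y -/e => h; apply: le_trans h _.
    by rewrite ler_pdivrMr ?/y; [nra|lra].
  have e0 : 0 < e by exact: lt_le_trans u0 e_lo.
  pose K := (j ^ 3)%N.
  have K0 : (0 < K)%N by rewrite expn_gt0 j0.
  pose D k := - ln (mertens_product R (exp_floor R k).+1) - series (@harmonic R) k.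
  have D0 : D 0%N = 0.
    rewrite /D; have -> : exp_floor R 0 = 1%N.
      apply/eqP; rewrite eqn_leq exp_floorP expR0 lexx andbT.
      by rewrite leqNgt exp_floorP expR0 -ltNge ltr1n.
    rewrite ln_mertens_product big_mkcond/= !big_nat_recr//= big_geq//.
    by rewrite seriesEnat/= big_geq// !addr0 subr0.
  have := abel_lower y01 C0 D0 K0 hC.
  have -> : \sum_(k < K) y ^+ k.+1 * (D k.+1 - D k) =
     \sum_(k < K) y ^+ k.+1 *
    (- ln (mertens_product R (exp_floor R k.+1).+1)
     - - ln (mertens_product R (exp_floor R k).+1)) - \sum_(k < K) y ^+ k.+1 / k.+1%:R.
    rewrite -sumrB; apply: eq_bigr => k _; rewrite /D.
    have -> : series (@harmonic R) k.+1 = series (@harmonic R) k + k.+1%:R^-1.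
      by rewrite !seriesEnat/= big_nat_recr.
    by move: (ln _) (ln _) (series _ _) (_^-1) (_ ^+ _) => a b f g h; ring.
  have hB := @block_lower R e K e0; rewrite -ye in hB.
  have hP := @prime_series_le R e j (exp_floor R K).+1 e0 j0; rewrite -/J in hP.
  have := ln_series K y01.
  have -> : 1 - y = u by rewrite /y; ring.
  move=> /andP[hS1 hS2].
  move: hS1 hS2 hB hP.
  set S := \sum_(k < K) y ^+ k.+1 / k.+1%:R.
  set G := \sum_(k < K) _; set P := \sum_(_ <= _ < _ | _) _.
  move=> hS1 hS2 hB hP hA.
  have lu : - ln u = 2 * ln J.
    by rewrite /u lnV ?posrE ?exprn_gt0// opprK lnXn// mulr_natl.
  have lJ : ln J <= J by exact/ltW/ln_sublinear.
  have KE : K%:R = J ^+ 3 :> R by rewrite natrX.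
  have tail : y ^+ K.+1 / (K.+1%:R * u) <= J^-1.
    apply: (@le_trans _ _ (1 / (K%:R * u))).
      have yK : y ^+ K.+1 <= 1 by case/andP: y01 => h1 h2; rewrite exprn_ile1// ltW.
      have k1 : 0 < K%:R * u by rewrite mulr_gt0// ltr0n.
      have k2 : K%:R * u <= K.+1%:R * u by rewrite ler_wpM2r ?(ltW u0)// ler_nat.
      have k3 : (K.+1%:R * u)^-1 <= (K%:R * u)^-1.
        by rewrite lef_pV2 ?posrE//; exact: lt_le_trans k2.
      have k4 : 0 <= (K.+1%:R * u)^-1 by rewrite invr_ge0 (le_trans (ltW k1)).
      by apply: le_trans (ler_wpM2r k4 yK) _; rewrite !mul1r.
    rewrite KE /u le_eqVlt; apply/orP; left; apply/eqP.
    by field; rewrite gt_eqF.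
  have le1 : ln (1 + e^-1) <= 2 * ln J + u.
    have h1 : e^-1 <= J ^+ 2 by rewrite -[J ^+ 2]invrK lef_pV2 ?posrE.
    have p1 : 0 < 1 + e^-1 by rewrite addr_gt0// invr_gt0.
    have p2 : 0 < J ^+ 2 by rewrite exprn_gt0.
    have := ln_tangent p2 p1; rewrite lnXn// -mulr_natl.
    have : (1 + e^-1) / J ^+ 2 <= u + 1.
      rewrite mulrDl mul1r -/u lerD2l ler_pdivrMr// mul1r//.
    lra.
  have Ki : K%:R^-1 <= J^-1 :> R.
    by rewrite KE lef_pV2 ?posrE ?exprn_gt0//; nra.
  have uJ : u * J = J^-1 by rewrite /u; field; rewrite gt_eqF.
  have uJ1 : u <= J^-1 by rewrite -uJ ler_peMr ?(ltW u0)//; lra.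
  have uS : u * S <= 2 * J^-1.
    apply: le_trans (ler_wpM2l (ltW u0) hS1) _; rewrite lu mulrCA ler_wpM2l//.
    by rewrite -uJ ler_wpM2l// ltW.
  have CC : C * (K%:R^-1 + u * S) <= C * (3 * J^-1).
    by rewrite ler_wpM2l//; lra.
  have eJ : e * J <= 2 * J^-1.
    by rewrite -uJ mulrA ler_wpM2r ?(ltW J0).
  have dy : d * (3 / 4) <= d * y by rewrite ler_wpM2l// /y; lra.
  have tot : d * (3 / 4) <= (6 + 3 * C) * J^-1.
    move: hA hS2 hB hP tail le1 CC eJ uJ1 dy; rewrite lu.
    by move: (_ ^+ _ / _) (ln (1 + _)) (ln J) (C * _) => a b f g; lra.
  have := ler_wpM2r (ltW J0) tot.
  have -> : (6 + 3 * C) * J^-1 * J = 6 + 3 * C by rewrite -mulrA mulVf ?mulr1 ?gt_eqF.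
  by have := C0; lra.
rewrite -subr_le0 -/d leNgt; apply/negP => d0.
pose j := maxn 2 (Num.truncn (2 * (5 + 3 * C) / d)).+1.
have jd : 2 * (5 + 3 * C) / d < j%:R.
  apply: lt_le_trans (truncnS_gt _) _; rewrite ler_nat; exact: leq_maxr.
have [|h|h] := key j; first by rewrite leq_maxl.
  by move: jd; rewrite ltr_pdivrMr// => h2; move: h h2; move: (j%:R) => J; lra.
by move: d0; rewrite ltNge h.
Qed.

Lemma mertens_const_exists (R : realType) : {c : R | mertens_const c}.
Proof. exact: mangoldt_limit. Qed.

(** * Numerical verification up to 10^4 *)

Lemma ln_succ_trapezoid (R : realType) (x : R) : 0 <= x <= 2^-1 ->
  2 * x / (2 + x) <= ln (1 + x) <= x * (2 + x) / (2 * (1 + x)).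
Proof.
move=> /andP[x0 x2]; apply/andP; split.
  apply: le_trans (ln1D_ge x0); rewrite ler_pdivrMr; last by lra.
  rewrite -subr_ge0 (_ : _ - _ = x ^+ 3 * (1 / 6 - x / 6 - x ^+ 2 / 4)); last by field.
  by rewrite mulr_ge0 ?exprn_ge0//; nra.
apply: le_trans (ln1D_le x0) _; rewrite ler_pdivlMr; last by lra.
rewrite -subr_ge0 (_ : _ - _ = x ^+ 3 * (1 / 3 - x / 6 + x ^+ 2 / 10 - 2 / 5 * x ^+ 3)).
  rewrite mulr_ge0 ?exprn_ge0//.
  have : x ^+ 3 <= x ^+ 2 / 2 by rewrite exprSr ler_wpM2l ?exprn_ge0//; lra.
  by nra.
by field.
Qed.

Definition small_primes : seq N :=
  [:: 2; 3; 5; 7; 11; 13; 17; 19; 23; 29; 31; 37; 41; 43; 47; 53; 59; 61; 67;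
      71; 73; 79; 83; 89; 97]%num.

Definition trial_prime (v : N) : bool :=
  all (fun d => (N.eqb d v) || ~~ (N.eqb (N.modulo v d) 0%num)) small_primes.

Lemma N_dvd_mod (v d : N) : d <> 0%num ->
  N.eqb (N.modulo v d) 0%num = (N.to_nat d %| N.to_nat v)%N.
Proof.
move=> d0; apply/idP/idP.
  move=> /N.eqb_eq h; rewrite (N.div_mod v d d0) h N.add_0_r N2Nat.inj_mul.
  exact: dvdn_mulr.
move=> /dvdnP[k e]; apply/N.eqb_eq.
have -> : v = N.mul (N.of_nat k) d.
  by apply: N2Nat.inj; rewrite N2Nat.inj_mul Nat2N.id e.
exact: N.mod_mul.
Qed.

Lemma small_primes_complete (q : nat) : prime q -> (q <= 100)%N ->
  exists2 d, d \in small_primes & N.to_nat d = q.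
Proof.
move=> pq q100.
have : all (fun q => prime q ==> (N.of_nat q \in small_primes)) (iota 0 101).
  by vm_compute.
move=> /allP/(_ q); rewrite mem_iota ltnS q100 => /(_ isT)/implyP/(_ pq) h.
by exists (N.of_nat q) => //; rewrite Nat2N.id.
Qed.

Lemma trial_primeP (v : N) : (1 < N.to_nat v)%N -> (N.to_nat v <= 100 ^ 2)%N ->
  trial_prime v = prime (N.to_nat v).
Proof.
move=> v1 v2; have v0 := ltnW v1.
have dsP : forall d, d \in small_primes -> prime (N.to_nat d) /\ d <> 0%num.
  have : all (fun d => prime (N.to_nat d) && ~~ N.eqb d 0) small_primes by vm_compute.
  by move=> /allP h d /h/andP[-> /negP d0]; split=> // e; apply: d0; rewrite e.
apply/idP/idP => [/allP h|pv]; last first.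
  apply/allP => d /dsP[pd d0]; rewrite N_dvd_mod// dvdn_prime2//.
  have [/eqP/N2Nat.inj ->|_] := boolP (N.to_nat d == N.to_nat v).
    by rewrite N.eqb_refl.
  by rewrite orbT.
apply/negPn/negP => /primePns[]; first by rewrite ltnNge v1.
move=> [q [pq q2 qv]].
have q100 : (q <= 100)%N by rewrite -(@leq_exp2r _ _ 2)// (leq_trans q2).
have [d dP dq] := small_primes_complete pq q100.
have [_ d0] := dsP _ dP; have := h _ dP; rewrite N_dvd_mod// dq qv orbF.
move=> /N.eqb_eq e; move: pq q2; rewrite -dq e => pv.
by rewrite -{2}[N.to_nat v]expn1 leq_exp2l// prime_gt1.
Qed.

Definition bracket : Type := (N * N * N * N * N)%type.

(* The state [(v, mh, ml, lh, ll)] brackets, in units of [1/S], the Mertens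
   product over the primes [<= v] in [[ml, mh]] and [ln v] in [[ll, lh]]. *)
Definition bracket_step (S : N) (st : bracket) : option bracket :=
  let: (v, mh, ml, lh, ll) := st in
  let v1 := N.succ v in
  let lh1 := (lh + (S * (2 * v + 1) / (2 * v * v1) + 1))%num in
  let ll1 := (ll + S * 2 / (2 * v + 1))%num in
  if trial_prime v1 then
    if N.leb (61 * 73 * mh * lh1)%num (50 * 50 * S * S)%num &&
       N.leb (9 * 139 * S * S)%num (40 * 50 * ml * (S * 549 / 500 + ll1))%num
    then Some (v1, (mh * v / v1 + 1)%num, (ml * v / v1)%num, lh1, ll1)
    else None
  else Some (v1, mh, ml, lh1, ll1).

Fixpoint bracket_run (S : N) (k : nat) (st : bracket) : option bracket :=
  if k is k'.+1 then
    if bracket_step S st is Some st' then bracket_run S k' st' else None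
  else Some st.

Definition NtoR (R : realType) (n : N) : R := (N.to_nat n)%:R.

Section NtoR_theory.
Context {R : realType}.
Local Notation NR := (NtoR R).

Lemma NtoR_ge0 n : 0 <= NR n. Proof. by []. Qed.

Lemma NtoRD a b : NR (a + b)%num = NR a + NR b.
Proof. by rewrite /NtoR N2Nat.inj_add natrD. Qed.

Lemma NtoRM a b : NR (a * b)%num = NR a * NR b.
Proof. by rewrite /NtoR N2Nat.inj_mul natrM. Qed.

Lemma NtoRS a : NR (N.succ a) = NR a + 1.
Proof. by rewrite /NtoR N2Nat.inj_succ natr1. Qed.

Lemma NtoR_leb a b : N.leb a b -> NR a <= NR b.
Proof.
by move=> /N.leb_le h; rewrite ler_nat; lia.
Qed.

Lemma NtoR_gt0 b : b <> 0%num -> 0 < NR b.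
Proof.
move=> b0; rewrite ltr0n lt0n; apply/eqP => h.
by apply: b0; apply: N2Nat.inj.
Qed.

Lemma NtoR_div a b : b <> 0%num ->
  NR (a / b)%num <= NR a / NR b <= NR (a / b)%num + 1.
Proof.
move=> b0; have h := N.div_mod a b b0; have lt := N.mod_lt a b b0.
have b0' := NtoR_gt0 b0.
have e : NR a = NR b * NR (a / b)%num + NR (N.modulo a b).
  by rewrite {1}h NtoRD NtoRM.
have h2 : NR (N.modulo a b) <= NR b by apply/NtoR_leb/N.leb_le/N.lt_le_incl.
have h3 := NtoR_ge0 (N.modulo a b).
by rewrite ler_pdivlMr// ler_pdivrMr// e; apply/andP; split; lra.
Qed.

End NtoR_theory.

Definition bracket_inv (R : realType) (S : N) (n : nat) (st : bracket) : Prop :=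
  let: (v, mh, ml, lh, ll) := st in
  [/\ N.to_nat v = n,
      NtoR R ml <= NtoR R S * mertens_product R n.+1 <= NtoR R mh &
      NtoR R ll <= NtoR R S * ln n%:R <= NtoR R lh].

(* The constants are products of small factors because large unary literals are
   costly: 61 * 73 / 50^2 = 1.7812 bounds e^gamma from above and
   9 * 139 / 2000 = 1251 / 2000 bounds e^(-c) from above. *)
Definition mertens_checked (R : realType) (p : nat) : Prop :=
  mertens_product R p * ln p%:R <= 50 * 50 / (61 * 73) /\
  9 * 139 / (40 * 50) <= mertens_product R p * (ln 3 + ln p%:R).

Lemma mertens_productS (R : realType) (n : nat) : mertens_product R n.+1 =
  mertens_product R n * (if prime n then 1 - n%:R^-1 else 1).
Proof.
by rewrite /mertens_product big_mkcond big_nat_recr//= -big_mkcond.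
Qed.

Lemma check_upper (R : realType) (s M l mh lh : R) : 0 < s -> 0 <= M -> 0 <= l ->
  s * M <= mh -> s * l <= lh -> 61 * 73 * mh * lh <= 50 * 50 * s * s ->
  M * l <= 50 * 50 / (61 * 73).
Proof.
move=> s0 M0 l0 hM hl h; have ss : 0 < s * s by rewrite mulr_gt0.
have h1 : s * M * (s * l) <= mh * lh.
  by apply: ler_pM => //; rewrite mulr_ge0// ltW.
have c0 : 0 < 61 * 73 :> R by rewrite mulr_gt0.
rewrite ler_pdivlMr// -(ler_pM2l ss).
move: c0 h h1; move: (61 * 73 : R) (50 * 50 : R) => a b c0 h h1.
have := ler_wpM2l (ltW c0) h1; lra.
Qed.

Lemma check_lower (R : realType) (s M l t ml ll l3 : R) : 0 < s -> 0 <= ml ->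
  0 <= l3 -> 0 <= ll -> ml <= s * M -> l3 <= s * t -> ll <= s * l ->
  9 * 139 * s * s <= 40 * 50 * ml * (l3 + ll) ->
  9 * 139 / (40 * 50) <= M * (t + l).
Proof.
move=> s0 m0 l30 ll0 hM h3 hl h; have ss : 0 < s * s by rewrite mulr_gt0.
have h1 : ml * (l3 + ll) <= s * M * (s * t + s * l).
  by apply: ler_pM => //; [exact: addr_ge0 | exact: lerD].
have c0 : 0 < 40 * 50 :> R by rewrite mulr_gt0.
rewrite ler_pdivrMr// -(ler_pM2l ss).
move: c0 h h1; move: (40 * 50 : R) (9 * 139 : R) => a b c0 h h1.
have := ler_wpM2l (ltW c0) h1; lra.
Qed.

Lemma bracket_stepP (R : realType) (S : N) (n : nat) (st st' : bracket) :
  S <> 0%num -> (1 < n)%N -> (n < 100 ^ 2)%N -> bracket_inv R S n st ->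
  bracket_step S st = Some st' ->
  bracket_inv R S n.+1 st' /\ (prime n.+1 -> mertens_checked R n.+1).
Proof.
move=> S0 n1 n2; case: st => [[[[v mh] ml] lh] ll] [vn hm hl]; rewrite /bracket_step.
have v1n : N.to_nat (N.succ v) = n.+1 by rewrite N2Nat.inj_succ vn.
have v1p : trial_prime (N.succ v) = prime n.+1.
  by rewrite trial_primeP v1n// ltnS ltnW.
have vR : NtoR R v = n%:R by rewrite /NtoR vn.
have v1R : NtoR R (N.succ v) = n%:R + 1 by rewrite NtoRS vR.
have v0 : v <> 0%num by move=> e; move: n1; rewrite -vn e.
have nge : 2 <= n%:R :> R by rewrite ler_nat.
have n0 : 0 < n%:R :> R by lra.
have SR := NtoR_gt0 (R := R) S0; have S0' := ltW SR.
have c1 : NtoR R 1%num = 1 by [].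
have c2 : NtoR R 2%num = 2 by [].
set lh1 := (lh + _)%num; set ll1 := (ll + _)%num.
have lnS : ln n.+1%:R = ln n%:R + ln (1 + n%:R^-1) :> R.
  rewrite -lnM ?posrE ?addr_gt0 ?invr_gt0//; congr ln.
  by rewrite mulrDr mulr1 divff ?gt_eqF// natr1.
have xle : 0 <= (n%:R^-1 : R) <= 2^-1.
  by rewrite invr_ge0 (ltW n0)/= lef_pV2 ?posrE.
have /andP[lo hi] := ln_succ_trapezoid xle.
have hl1 : NtoR R ll1 <= NtoR R S * ln n.+1%:R <= NtoR R lh1.
  have d1 : (2 * v * N.succ v)%num <> 0%num by clear -v0; lia.
  have d2 : (2 * v + 1)%num <> 0%num by clear -v0; lia.
  have /andP[_ q1] := @NtoR_div R (S * (2 * v + 1))%num _ d1.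
  have /andP[q2 _] := @NtoR_div R (S * 2)%num _ d2.
  rewrite lnS /lh1 /ll1 !NtoRD c1 mulrDr.
  move: q1 q2; rewrite !(NtoRM, NtoRD, NtoRS) vR c1 c2.
  have -> : NtoR R S * (2 * n%:R + 1) / (2 * n%:R * (n%:R + 1)) =
     NtoR R S * (n%:R^-1 * (2 + n%:R^-1) / (2 * (1 + n%:R^-1))).
    by field; rewrite !gt_eqF//; lra.
  have -> : NtoR R S * 2 / (2 * n%:R + 1) =
     NtoR R S * (2 * n%:R^-1 / (2 + n%:R^-1)).
    by field; rewrite !gt_eqF//; lra.
  have := ler_wpM2l S0' lo; have := ler_wpM2l S0' hi; move: hl.
  move: (NtoR R (_ / _)%num) (NtoR R (_ / _)%num) (ln (1 + _)) => a b c.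
  by move=> /andP[? ?] *; apply/andP; split; lra.
move: lh1 ll1 hl1 => lh1 ll1 hl1.
case: ifP => [tp|ntp]; last first.
  move=> [<-]; split; last by rewrite -v1p ntp.
  by split=> //; rewrite mertens_productS -v1p ntp mulr1.
case: ifP => // /andP[k1 k2] [<-]; have pn : prime n.+1 by rewrite -v1p.
have Mp := mertens_product_gt0 R n.+1.
have d3 : N.succ v <> 0%num by clear -v0; lia.
split; last first.
  move=> _; have := NtoR_leb (R := R) k1; have := NtoR_leb (R := R) k2.
  have d4 : 500%num <> 0%num by [].
  have /andP[q3 _] := @NtoR_div R (S * 549)%num 500%num d4.
  rewrite !(NtoRM, NtoRD) in q3 *.
  rewrite -[NtoR R 549%num]/(549%:R) -[NtoR R 500%num]/(500%:R) in q3.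
  rewrite -[NtoR R 61%num]/(61%:R) -[NtoR R 73%num]/(73%:R).
  rewrite -[NtoR R 50%num]/(50%:R) -[NtoR R 40%num]/(40%:R).
  rewrite -[NtoR R 9%num]/(9%:R) -[NtoR R 139%num]/(139%:R).
  have [_ /andP[b3 _] _] := ln235_bounds R.
  have q4 : NtoR R S * 549 / 500 <= NtoR R S * ln 3.
    by rewrite -mulrA ler_wpM2l//; lra.
  have ln0 : 0 <= ln n.+1%:R :> R by rewrite ln_ge0// ler1n.
  have ll0 := NtoR_ge0 (R := R) ll1; have ml0 := NtoR_ge0 (R := R) ml.
  have l30 := NtoR_ge0 (R := R) (S * 549 / 500)%num.
  case/andP: hm => hm1 hm2; case/andP: hl1 => hl1 hl2.
  move=> K2 K1; split.
    exact: check_upper SR (ltW Mp) ln0 hm2 hl2 K1.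
  exact: check_lower SR ml0 l30 ll0 hm1 (le_trans q3 q4) hl1 K2.
split=> //; rewrite mertens_productS pn.
have -> : NtoR R S * (mertens_product R n.+1 * (1 - n.+1%:R^-1)) =
   NtoR R S * mertens_product R n.+1 * n%:R / (n%:R + 1).
  by rewrite -natr1; field; rewrite gt_eqF//; lra.
have /andP[_ q1] := @NtoR_div R (mh * v)%num _ d3.
have /andP[q2 _] := @NtoR_div R (ml * v)%num _ d3.
case/andP: hm => hm1 hm2; have i0 : 0 <= (n%:R + 1)^-1 :> R by rewrite invr_ge0; lra.
rewrite NtoRD c1; rewrite !NtoRM v1R vR in q1 q2; apply/andP; split.
  by apply: le_trans q2 _; apply: ler_wpM2r => //; apply: ler_wpM2r => //; exact: ltW.
by apply: le_trans q1; apply: ler_wpM2r => //; apply: ler_wpM2r => //; exact: ltW.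
Qed.

Lemma bracket_runP (R : realType) (S : N) (k n : nat) (st st' : bracket) :
  S <> 0%num -> (1 < n)%N -> (n + k <= 100 ^ 2)%N -> bracket_inv R S n st ->
  bracket_run S k st = Some st' ->
  bracket_inv R S (n + k)%N st' /\
  forall p, prime p -> (n < p <= n + k)%N -> mertens_checked R p.
Proof.
move=> S0; elim: k n st => [|k IH] n st n1 nk hst /=.
  move=> [<-]; rewrite addn0; split=> // p _ /andP[h1 h2].
  by move: h1; rewrite ltnNge h2.
case e : (bracket_step S st) => [st1|//] hrun.
have nlt : (n < 100 ^ 2)%N by apply: leq_trans nk; rewrite -addSnnS leq_addr.
have [h1 h2] := bracket_stepP S0 n1 nlt hst e.
rewrite -addSnnS in nk *.
have [h3 h4] := IH _ _ (leqW n1) nk h1 hrun; split=> // p pp /andP[np pk].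
move: np; rewrite leq_eqVlt => /orP[/eqP ep|np]; last by apply: h4; rewrite ?np.
by move: pp; rewrite -ep; exact: h2.
Qed.

Definition bracket_scale : N := 10000000000000%num.

Definition bracket_start : bracket :=
  let S := bracket_scale in
  (9, S * 8 / 35 + 1, S * 8 / 35, S * 2 * 1099 / 1000 + 1, S * 2 * 549 / 500)%num.

Definition bracket_final (st : bracket) : bool :=
  let: (v, mh, ml, lh, ll) := st in
  let S := bracket_scale in N.leb (40 * 50 * mh * lh)%num (123 * S * S + 1000 * S * S)%num.

Lemma bracket_compute :
  if bracket_run bracket_scale (100 ^ 2 - 9) bracket_start is Some st
  then bracket_final st else false.
Proof. by vm_compute. Qed.

Lemma mertens_product_10 (R : realType) :
  [/\ mertens_product R 3 = 1 / 2, mertens_product R 5 = 1 / 3,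
      mertens_product R 7 = 4 / 15 & mertens_product R 10 = 8 / 35].
Proof.
have M3 : mertens_product R 3 = 1 / 2.
  rewrite !mertens_productS /mertens_product big_geq//.
  by rewrite (_ : prime 2)// (_ : prime 1 = false)// (_ : prime 0 = false)//; field.
have M5 : mertens_product R 5 = 1 / 3.
  by rewrite 2!mertens_productS M3 (_ : prime 4 = false)// (_ : prime 3)//; field.
have M7 : mertens_product R 7 = 4 / 15.
  by rewrite 2!mertens_productS M5 (_ : prime 6 = false)// (_ : prime 5)//; field.
split=> //; rewrite 3!mertens_productS M7.
by rewrite (_ : prime 9 = false)// (_ : prime 8 = false)// (_ : prime 7)//; field.
Qed.

Lemma bracket_start_inv (R : realType) : bracket_inv R bracket_scale 9 bracket_start.
Proof.
rewrite /bracket_start; have : bracket_scale <> 0%num by [].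
move: bracket_scale => S S0.
have S0' := ltW (NtoR_gt0 (R := R) S0).
have c1 : NtoR R 1%num = 1 by [].
have [_ _ _ M10] := mertens_product_10 R.
have l9 : ln 9%:R = ln 3 + ln 3 :> R by rewrite -lnM ?posrE// -natrM.
have [_ /andP[b1 b2] _] := ln235_bounds R.
split=> //.
  rewrite M10; have d : 35%num <> 0%num by [].
  have := @NtoR_div R (S * 8)%num 35%num d; rewrite NtoRD c1 NtoRM.
  by rewrite -[NtoR R 8%num]/(8%:R) -[NtoR R 35%num]/(35%:R) -mulrA.
have d1 : 500%num <> 0%num by [].
have d2 : 1000%num <> 0%num by [].
have /andP[q1 _] := @NtoR_div R (S * 2 * 549)%num 500%num d1.
have /andP[_ q2] := @NtoR_div R (S * 2 * 1099)%num 1000%num d2.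
rewrite l9 NtoRD c1; apply/andP; split.
  apply: le_trans q1 _; rewrite !NtoRM -!mulrA ler_wpM2l//.
  rewrite -[NtoR R 2%num]/(2%:R) -[NtoR R 549%num]/(549%:R) -[NtoR R 500%num]/(500%:R).
  by move: b1; move: (ln 3) => l; lra.
apply: le_trans q2; rewrite !NtoRM -!mulrA ler_wpM2l//.
rewrite -[NtoR R 2%num]/(2%:R) -[NtoR R 1099%num]/(1099%:R) -[NtoR R 1000%num]/(1000%:R).
by move: b2; move: (ln 3) => l; lra.
Qed.

Lemma bracket_result (R : realType) :
  (forall p, prime p -> (9 < p <= 100 ^ 2)%N -> mertens_checked R p) /\
  mertens_product R (100 ^ 2).+1 * ln (100 ^ 2)%:R <= 1123 / (40 * 50).
Proof.
have S0 : bracket_scale <> 0%num by [].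
have e : (9 + (100 ^ 2 - 9) = 100 ^ 2)%N by rewrite subnKC.
have := bracket_compute; have := bracket_start_inv R; rewrite /bracket_final.
move: bracket_scale S0 bracket_start => S S0 st0 hst0.
case er : (bracket_run S (100 ^ 2 - 9) st0) => [st|//] hf.
have nk : (9 + (100 ^ 2 - 9) <= 100 ^ 2)%N by rewrite e.
have [] := bracket_runP S0 (isT : (1 < 9)%N) nk hst0 er.
rewrite e => hst hp; split=> //.
case: st hf hst {er} => [[[[v mh] ml] lh] ll] hf [_ /andP[_ hm] /andP[_ hl]].
have SR := NtoR_gt0 (R := R) S0.
have := NtoR_leb (R := R) hf; rewrite NtoRD !NtoRM.
rewrite -[NtoR R 40%num]/(40%:R) -[NtoR R 50%num]/(50%:R).
rewrite -[NtoR R 123%num]/(123%:R) -[NtoR R 1000%num]/(1000%:R).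
have l0 : 0 <= ln (100 ^ 2)%:R :> R by rewrite ln_ge0// ler1n.
have M0 := mertens_product_gt0 R (100 ^ 2).+1.
move: l0 M0 hm hl; move: (mertens_product _ _) (ln _) => M l l0 M0 hm hl h.
have ss : 0 < NtoR R S * NtoR R S by rewrite mulr_gt0.
have h1 : NtoR R S * M * (NtoR R S * l) <= NtoR R mh * NtoR R lh.
  by apply: ler_pM => //; rewrite mulr_ge0// ltW.
have c0 : 0 < 40 * 50 :> R by rewrite mulr_gt0.
rewrite ler_pdivlMr// -(ler_pM2l ss).
have := ler_wpM2l (ltW c0) h1; lra.
Qed.

Lemma mertens_checked_small (R : realType) (p : nat) :
  prime p -> (2 < p <= 100 ^ 2)%N -> mertens_checked R p.
Proof.
move=> pp /andP[p2 pN]; have [p9|p9] := leqP p 9; last first.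
  by have [h _] := bracket_result R; apply: h; rewrite ?p9.
have [M3 M5 M7 _] := mertens_product_10 R.
have [/andP[a1 a2] /andP[b1 b2] /andP[c1 c2]] := ln235_bounds R.
have : p \in [:: 3; 5; 7]%N.
  by case: p pp p2 p9 {pN} => // -[|[|[|[|[|[|[|[|[|[|p]]]]]]]]]].
rewrite !inE => /or3P[]/eqP ->; rewrite /mertens_checked.
- rewrite M3; split; rewrite ?ler_pdivlMr ?ler_pdivrMr ?mulr_gt0//;
    move: b1 b2; move: (ln _) => l; clear; lra.
- rewrite M5; split; rewrite ?ler_pdivlMr ?ler_pdivrMr ?mulr_gt0//;
    move: b1 b2 c1 c2; move: (ln 5) (ln _) => l m; clear; lra.
have l7 : ln 7%:R <= ln 2 + ln 2 + ln 2 :> R.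
  by rewrite -!lnM ?posrE ?mulr_gt0// ler_ln ?posrE ?mulr_gt0// -!natrM ler_nat.
have l7' : ln 2 + ln 3 <= ln 7%:R :> R.
  by rewrite -!lnM ?posrE ?mulr_gt0// ler_ln ?posrE ?mulr_gt0// -!natrM ler_nat.
rewrite M7; split; rewrite ?ler_pdivlMr ?ler_pdivrMr ?mulr_gt0//;
  move: l7 l7' a1 a2 b1 b2; move: (ln 7%:R) (ln 2) (ln 3) => l m n; clear; lra.
Qed.

(** * Explicit bounds on Mertens products *)

Section mertens_const_bounds.
Context {R : realType}.
Variable c : R.
Hypothesis hc : mertens_const c.
Local Notation M := (mertens_product R).

Lemma ln_mertens_lower N : (100 ^ 2 <= N)%N ->
  ln (ln N%:R) + c - osc_bound R N <= - ln (M N.+1).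
Proof.
move=> hN; have := hc hN; rewrite ler_distl => /andP[h _].
have := mangoldt_sum_le R N; move: h; rewrite /mangoldt_defect.
by move: (osc_bound _ _) (mangoldt_sum _ _) (ln (ln _)) (ln (M _)) => *; lra.
Qed.

Lemma ln_mertens_upper N s : (100 ^ 2 <= N)%N -> (0 < s)%N -> (s ^ 2 <= N)%N ->
  - ln (M N.+1) <= ln (ln N%:R) + c + osc_bound R N + 7 / 6 / s%:R.
Proof.
move=> hN s0 hs; have := hc hN; rewrite ler_distl => /andP[_ h].
have := @mangoldt_sum_ge R N s s0 hs; move: h; rewrite /mangoldt_defect.
move: (osc_bound _ _) (mangoldt_sum _ _) (ln (ln _)) (ln (M _)) (7 / 6 / _) => *; lra.
Qed.

Lemma ex_isqrt N : (100 ^ 2 <= N)%N ->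
  exists2 s, (100 <= s)%N & (s ^ 2 <= N < s.+1 ^ 2)%N.
Proof.
move=> hN; have ex : exists s, (N < s.+1 ^ 2)%N.
  by exists N; rewrite expnS expn1 (leq_trans (ltnSn N))// leq_pmulr.
case: (ex_minnP ex) => s hs mins; exists s.
  by have := leq_ltn_trans hN hs; rewrite ltn_exp2r.
rewrite hs andbT; case: s hs mins => [|s] hs mins; first by rewrite exp0n.
rewrite leqNgt; apply/negP => h; have := mins s h.
by rewrite ltnn.
Qed.

Lemma ln_le_isqrt N s : (N < s.+1 ^ 2)%N -> (0 < N)%N ->
  ln N%:R <= 724 / 100 + 2 / 100 * s%:R :> R.
Proof.
move=> h N0; have s0 : 0 < s.+1%:R :> R by [].
have h1 : ln N%:R <= ln (s.+1%:R ^+ 2) :> R.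
  by rewrite ler_ln ?posrE ?exprn_gt0 ?ltr0n// -natrX ler_nat ltnW.
have h2 := ln_tangent (ltr0Sn R 99) s0.
have l100 : ln 100%:R = 2 * (ln 2 + ln 5) :> R.
  have -> : 100%:R = (2 * 5) * (2 * 5) :> R by ring.
  by rewrite !lnM ?posrE ?mulr_gt0//; ring.
have [/andP[_ a2] _ /andP[_ b2]] := ln235_bounds R.
apply: le_trans h1 _; rewrite lnXn// -[leLHS]mulr_natl.
have e1 : s.+1%:R = s%:R + 1 :> R by rewrite natr1.
move: h2; rewrite l100 e1.
move: a2 b2; move: (ln (s%:R + 1)) => n; move: (ln 5) => m; move: (ln 2) => l; lra.
Qed.

Lemma error_le N s : (100 ^ 2 <= N)%N -> (100 <= s)%N -> (s ^ 2 <= N)%N ->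
  osc_bound R N + 7 / 6 / s%:R <= 881 / 1000 / ln N%:R + 1177 / 1000 / s%:R.
Proof.
move=> hN s100 hs; rewrite /osc_bound -addrA lerD2l.
have s1 : 100 <= s%:R :> R by rewrite ler_nat.
have N1 : N.-1%:R = N%:R - 1 :> R by rewrite -subn1 natrB// (leq_trans _ hN).
have hs' : s%:R ^+ 2 <= N%:R :> R by rewrite -natrX ler_nat.
have h : 99 * s%:R <= N.-1%:R :> R by rewrite N1; nra.
have h2 : N.-1%:R^-1 <= 1 / 99 / s%:R :> R.
  rewrite div1r -invfM lef_pV2 ?posrE//; last by rewrite mulr_gt0//; lra.
  by apply: lt_le_trans h; rewrite mulr_gt0//; lra.
have i0 : 0 <= s%:R^-1 :> R by rewrite invr_ge0; lra.
lra.
Qed.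

Lemma error_le_const N s : (100 ^ 2 <= N)%N -> (100 <= s)%N -> (s ^ 2 <= N)%N ->
  osc_bound R N + 7 / 6 / s%:R <= 1075 / 10000.
Proof.
move=> hN s100 hs; apply: le_trans (error_le hN s100 hs) _.
have s1 : 100 <= s%:R :> R by rewrite ler_nat.
have l1 := @ln_ge_10000 R N hN.
have l0 : 0 < ln N%:R :> R by lra.
have h1 : (ln N%:R)^-1 <= 100 / 921 :> R by rewrite -div1r ler_pdivrMr; lra.
have h2 : s%:R^-1 <= 1 / 100 :> R by rewrite -div1r ler_pdivrMr; lra.
move: h1 h2; move: ((ln N%:R)^-1) (s%:R^-1) => a b h1 h2.
clear -h1 h2; lra.
Qed.

Lemma expR_error_le : expR (1075 / 10000) <= 1251 / 1123 :> R.
Proof.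
have x0 : 0 <= 128 / 1123 :> R by lra.
have -> : 1251 / 1123 = 1 + 128 / 1123 :> R by lra.
have h : 1075 / 10000 <= ln (1 + 128 / 1123) :> R.
  by apply: le_trans (ln1D_ge x0); lra.
have x1 : 0 < 1 + 128 / 1123 :> R by lra.
move: (1 + _ : R) (1075 / _ : R) x1 h => x y x1 h.
by rewrite -[leRHS]lnK ?posrE// ler_expR.
Qed.

Lemma const_mertens_ge N : (100 ^ 2 <= N)%N ->
  1123 / 1251 <= expR c * M N.+1 * ln N%:R.
Proof.
move=> hN; have [s s100 /andP[hs _]] := ex_isqrt hN.
have s0 : (0 < s)%N by apply: leq_trans s100.
have h := ln_mertens_upper hN s0 hs; have e := error_le_const hN s100 hs.
have l1 := @ln_ge_10000 R N hN; have l0 : 0 < ln N%:R :> R by lra.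
have M0 := mertens_product_gt0 R N.+1.
have E := expR_error_le.
have -> : 1123 / 1251 = (1251 / 1123)^-1 :> R by rewrite invf_div.
have r0 : 0 < 1251 / 1123 :> R by clear -hc; lra.
move: (1075 / 10000 : R) (1251 / 1123 : R) e E r0 => k r e E r0.
have h1 : - k <= c + ln (M N.+1) + ln (ln N%:R).
  move: h e; move: (ln (M _)) (ln (ln _)) (osc_bound _ _) (7 / 6 / _) => x y z t.
  by clear; lra.
have h2 : expR (- k) <= expR c * M N.+1 * ln N%:R.
  by rewrite -[M _]lnK ?posrE// -[X in _ * X]lnK ?posrE// -!expRD ler_expR.
by apply: le_trans h2; rewrite expRN lef_pV2 ?posrE ?expR_gt0.
Qed.

Lemma const_ge : 2000 / 1251 <= expR c.
Proof.
have [_ hM] := bracket_result R.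
have h := const_mertens_ge (leqnn (100 ^ 2)).
have C0 := expR_gt0 c.
move: hM h; rewrite -mulrA => /(ler_wpM2l (ltW C0)); move: (expR c * (_ * _)) => x.
by move: (expR c) => C h1 h2; lra.
Qed.

Lemma mertens_lt_const N : (100 ^ 2 <= N)%N ->
  1 <= expR c * M N.+1 * (ln 3 + ln N%:R).
Proof.
move=> hN; have [s s100 /andP[hs hs']] := ex_isqrt hN.
have s0 : (0 < s)%N by apply: leq_trans s100.
have h := ln_mertens_upper hN s0 hs; have e := error_le hN s100 hs.
have l1 := @ln_ge_10000 R N hN; have l0 : 0 < ln N%:R :> R by lra.
have M0 := mertens_product_gt0 R N.+1.
have N0 : (0 < N)%N by apply: leq_trans hN.
have lU := ln_le_isqrt hs' N0.
have s1 : 100 <= s%:R :> R by rewrite ler_nat.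
have [_ /andP[b1 b2] _] := ln235_bounds R.
set L := ln N%:R in l0 l1 lU h e *.
pose u := ln 3 / L.
have u0 : 0 <= u by rewrite divr_ge0//; move: b1 l0; clear -hc; lra.
have hu : u - u ^+ 2 / 2 <= ln (1 + u).
  have u1 : u <= 1 by rewrite ler_pdivrMr// mul1r; move: b2 l1; clear -hc; lra.
  apply: le_trans (ln1D_ge u0).
  rewrite -subr_ge0 (_ : _ - _ = u ^+ 3 * (3^-1 - u / 4)); last by field.
  by rewrite mulr_ge0 ?exprn_ge0//; move: u1; clear -hc; lra.
have key : osc_bound R N + 7 / 6 / s%:R <= ln (1 + u).
  apply: le_trans hu; apply: le_trans e _.
  have -> : u - u ^+ 2 / 2 = (ln 3 - ln 3 ^+ 2 / 2 / L) / L.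
    by rewrite /u; field; rewrite gt_eqF.
  have h3 : ln 3 ^+ 2 / 2 / L <= 66 / 1000 :> R.
    by rewrite ler_pdivrMr//; nra.
  have h4 : 1177 / 1000 / s%:R <= 151 / 1000 / L.
    rewrite ler_pdivrMr; last by move: s1; clear -hc; lra.
    by rewrite mulrAC ler_pdivlMr//; move: lU s1; clear -hc; lra.
  apply: (@le_trans _ _ ((881 / 1000 + 151 / 1000) / L)).
    by rewrite [leRHS](mulrDl (881 / 1000) (151 / 1000)) lerD2l.
  by rewrite ler_wpM2r ?invr_ge0 ?(ltW l0)//; move: h3 b1; clear -hc; lra.
have u1p : 0 < 1 + u by rewrite ltr_wpDr.
have e1 : ln 3 + L = L * (1 + u) by rewrite /u; field; rewrite gt_eqF.
rewrite e1 -[M _]lnK ?posrE// -[X in X * (1 + u)]lnK ?posrE//.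
rewrite -[1 + u]lnK ?posrE// -!expRD -[leLHS]expR0 ler_expR.
move: h key; move: (ln (M _)) (ln L) (osc_bound _ _) (7 / 6 / _) (ln (1 + u)) => x y z t w.
by clear; lra.
Qed.

Lemma strong_mertens (q : nat) : prime q -> (2 < q)%N ->
  1 <= expR c * M q * (ln 3 + ln q%:R).
Proof.
move=> pq q2; have C0 := expR_gt0 c.
have [qN|qN] := leqP q (100 ^ 2).
  have q2N : (2 < q <= 100 ^ 2)%N by rewrite q2.
  have [_ h] := @mertens_checked_small R q pq q2N.
  rewrite -mulrA; apply: le_trans (ler_wpM2l (ltW C0) h).
  by move: const_ge; move: (expR c) => C; clear; lra.
have hN : (100 ^ 2 <= q.-1)%N by rewrite -ltnS prednK// prime_gt0.
have := mertens_lt_const hN; rewrite prednK ?prime_gt0// => h.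
apply: le_trans h _; rewrite ler_wpM2l ?mulr_ge0 ?(ltW C0) ?(ltW (mertens_product_gt0 _ _))//.
have q1 : 0 < q.-1%:R :> R by rewrite ltr0n (leq_trans _ hN).
have q0 : 0 < q%:R :> R by rewrite ltr0n prime_gt0.
by rewrite lerD2l ler_ln ?posrE// ler_nat leq_pred.
Qed.

End mertens_const_bounds.

Lemma expR_gamma_le (R : realType) : expR (euler_gamma R) <= 61 * 73 / (50 * 50).
Proof.
have [_ /(_ isT) h] := harmonic_bounds R 39.
have hH : series (@harmonic R) 40 <= (4278 + 544 / 1000) / 1000.
  rewrite seriesEnat/= !big_nat_recr//= big_geq//.
  apply: (@le_trans _ _ (0 + 1^-1 + 2^-1 + 3^-1 + 4^-1 + 5^-1 + 6^-1 + 7^-1 + 8^-1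
    + 9^-1 + 10^-1 + 11^-1 + 12^-1 + 13^-1 + 14^-1 + 15^-1 + 16^-1
    + 17^-1 + 18^-1 + 19^-1 + 20^-1 + 21^-1 + 22^-1 + 23^-1 + 24^-1
    + 25^-1 + 26^-1 + 27^-1 + 28^-1 + 29^-1 + 30^-1 + 31^-1 + 32^-1
    + 33^-1 + 34^-1 + 35^-1 + 36^-1 + 37^-1 + 38^-1 + 39^-1 + 40^-1)).
    exact: lexx.
  by lra.
have e1 : 39%:R + 3 / 2 = 3 * (3 * (3 * 3)) / 2 :> R by lra.
have e2 : 61 * 73 / (50 * 50) = 2 * (2 * (2 * 2)) / (3 * 3) * (1 + 77 / (200 * 200)) :> R.
  by lra.
have x0 : 0 <= 77 / (200 * 200) :> R by lra.
have hx : 77 / (200 * 200) - 2 / (1000 * 1000) <= ln (1 + 77 / (200 * 200)) :> R.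
  by apply: le_trans (ln1D_ge x0); lra.
have x1 : 0 < 1 + 77 / (200 * 200) :> R by lra.
rewrite e2; rewrite e1 in h.
have h2 : 2 * (2 * (2 * 2)) / (3 * 3) * (1 + 77 / (200 * 200)) =
   expR (ln 2 + (ln 2 + (ln 2 + ln 2)) - (ln 3 + ln 3) + ln (1 + 77 / (200 * 200))) :> R.
  rewrite -!lnM ?posrE ?mulr_gt0// -ln_div ?posrE ?mulr_gt0//.
  rewrite -lnM ?posrE ?divr_gt0 ?mulr_gt0//.
  by rewrite lnK// posrE mulr_gt0 ?divr_gt0 ?mulr_gt0.
rewrite h2 ler_expR; move: h; rewrite ln_div ?posrE ?mulr_gt0// !lnM ?posrE ?mulr_gt0//.
have [/andP[a1 _] /andP[b1 _] _] := ln235_bounds R.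
move: hH hx a1 b1; move: (series _ _) => H; move: (ln (1 + _)) => w; move: (ln 3) => m.
by move: (ln 2) => l; clear; lra.
Qed.

Lemma mertens_sq_telescope (R : realType) (n k : nat) : (0 < n)%N ->
  \sum_(n.+1 <= p < n.+1 + k | prime p) mertens_product R p ^+ 2 / p%:R
  <= (mertens_product R n.+1 ^+ 2 - mertens_product R (n.+1 + k) ^+ 2) / (2 - n%:R^-1).
Proof.
move=> n0; have n0' : 0 < n%:R :> R by rewrite ltr0n.
have n1 : n%:R^-1 <= 1 :> R by rewrite invf_le1// ler1n.
have d0 : 0 < 2 - n%:R^-1 :> R by lra.
rewrite ler_pdivlMr//; elim: k => [|k IH].
  by rewrite addn0 big_geq// mul0r subrr.
rewrite addnS big_mkcond big_nat_recr/=; last by rewrite leq_addr.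
rewrite -big_mkcond mulrDl (mertens_productS R (n.+1 + k)); set q := (n.+1 + k)%N in IH *.
have := IH; move: (\sum_(_ <= _ < _ | _) _) (mertens_product R n.+1) => S M0 {}IH.
case: ifP => pq; last by rewrite mul0r mulr1 addr0.
have q0 : 0 < q%:R :> R by rewrite ltr0n.
have qn : q%:R^-1 <= n%:R^-1 :> R.
  by rewrite lef_pV2 ?posrE// ler_nat /q (leq_trans (leqnSn n))// leq_addr.
have M2 : 0 <= mertens_product R q ^+ 2 / q%:R.
  by rewrite divr_ge0 ?exprn_ge0 ?(ltW (mertens_product_gt0 _ _)) ?(ltW q0).
have e : (mertens_product R q * (1 - q%:R^-1)) ^+ 2 =
   mertens_product R q ^+ 2 - mertens_product R q ^+ 2 / q%:R * (2 - q%:R^-1).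
  by ring.
rewrite e.
have : mertens_product R q ^+ 2 / q%:R * (2 - n%:R^-1) <=
   mertens_product R q ^+ 2 / q%:R * (2 - q%:R^-1) by rewrite ler_wpM2l//; lra.
move: IH; move: (mertens_product R q ^+ 2 / q%:R * _) (mertens_product R q ^+ 2 / q%:R * _) => a b.
by move: (S * _) (mertens_product R q ^+ 2) (M0 ^+ 2) => x y z; lra.
Qed.

(* With [C = expR (euler_gamma R)] the maximum discards the Mertens primes, and
   the sum over odd primes is [epsilon0]. *)
Definition surplus (R : realType) (C : R) (p : nat) : R :=
  Num.max 0 (C * mertens_product R p / p%:R - (p%:R * ln p%:R)^-1).

Lemma surplus_ge0 (R : realType) (C : R) p : 0 <= surplus C p.
Proof. by rewrite le_max lexx. Qed.

Section surplus_bound.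
Context {R : realType}.
Variable c : R.
Hypothesis hc : mertens_const c.
Local Notation M := (mertens_product R).
Local Notation C := (expR c).

Lemma const_le : C <= 61 * 73 / (50 * 50).
Proof.
apply: le_trans (expR_gamma_le R); rewrite ler_expR.
exact: mertens_const_le_gamma.
Qed.

Lemma surplus_small p : prime p -> (2 < p <= 100 ^ 2)%N -> surplus C p = 0.
Proof.
move=> pp /andP[p2 pN]; apply/max_idPl; rewrite subr_le0.
have p0 : 0 < p%:R :> R by rewrite ltr0n prime_gt0.
have l0 : 0 < ln p%:R :> R by rewrite ln_gt0// ltr1n prime_gt1.
have [h _] := @mertens_checked_small R p pp (introT andP (conj p2 pN)).
rewrite invfM mulrC ler_wpM2l ?invr_ge0 ?(ltW p0)//.
rewrite -[(ln _)^-1]div1r ler_pdivlMr// -mulrA.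
have M0 := mertens_product_gt0 R p.
have Ml : 0 <= M p * ln p%:R by rewrite mulr_ge0// ltW.
apply: le_trans (ler_wpM2r Ml const_le) _.
by move: h; move: (M p * _) => x; clear; lra.
Qed.

Lemma surplus_large p : prime p -> (100 ^ 2 < p)%N ->
  surplus C p <= 985 / 1000 * (C ^+ 2 * (M p ^+ 2 / p%:R)).
Proof.
move=> pp pN; have C0 := expR_gt0 c; have M0 := mertens_product_gt0 R p.
have p0 : 0 < p%:R :> R by rewrite ltr0n prime_gt0.
rewrite ge_max; apply/andP; split.
  have k0 : 0 <= 985 / 1000 :> R by lra.
  have : 0 <= C ^+ 2 * (M p ^+ 2 / p%:R).
    by rewrite !mulr_ge0 ?exprn_ge0 ?invr_ge0 ?(ltW C0) ?(ltW M0) ?(ltW p0).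
  exact: mulr_ge0.
have hN : (100 ^ 2 <= p.-1)%N by rewrite -ltnS prednK// prime_gt0.
have lo := ln_mertens_lower hc hN; have hi := const_mertens_ge hc hN.
have l1 := @ln_ge_10000 R _ hN; rewrite prednK ?prime_gt0// in lo hi.
have N0 : 0 < p.-1%:R :> R by rewrite ltr0n (leq_trans _ hN).
have xN : 100 * 100 <= p.-1%:R :> R by rewrite -natrM ler_nat.
have pE : p%:R = p.-1%:R + 1 :> R by rewrite natr1 prednK// prime_gt0.
have lp := ln_tangent N0 p0.
have lp2 : (p%:R / p.-1%:R) = 1 + (p.-1%:R)^-1 :> R by rewrite pE; field; rewrite gt_eqF.
have hw := lo; rewrite /osc_bound in hw.
have Npp : p.-1.-1%:R = p.-1%:R - 1 :> R by rewrite -[in LHS]subn1 natrB// (leq_trans _ hN).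
rewrite Npp in hw.
have iN : (p.-1%:R)^-1 <= 1 / (100 * 100) :> R by rewrite -div1r ler_pdivrMr; lra.
have hLN : ln p.-1%:R <= 2 / 1000 * (p.-1%:R - 1) :> R.
  have h0 : 0 < (100 ^ 2)%:R :> R by rewrite ltr0n.
  have := ln_tangent h0 N0; rewrite ln_10000 natrX.
  have [/andP[_ h2] _ /andP[_ h5]] := ln235_bounds R.
  move: h2 h5 xN; move: (ln p.-1%:R) => l; move: (ln 5) (ln 2) => a b; clear; lra.
set L := ln p.-1%:R in l1 lo hi lp hw hLN *.
set l := ln p%:R in lp *.
have L0 : 0 < L by lra.
have Ll : L <= l by rewrite ler_ln ?posrE// ler_nat leq_pred.
set A := C * M p in hi *; have A0 : 0 < A by rewrite mulr_gt0.
pose w := 881 / 1000 / L + (p.-1%:R - 1)^-1.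
have AL : A * L * (1 - w) <= 1.
  have h1 : ln (A * L) <= w.
    rewrite lnM ?posrE// /A lnM ?posrE// expRK.
    by move: hw; rewrite -/w; move: (ln (M p)) (ln L) => *; lra.
  have h2 : A * L <= expR w by rewrite -[A * L]lnK ?posrE ?mulr_gt0// ler_expR.
  have h3 : 1 - w <= expR (- w) := expR_ge1Dx _.
  have h4 : A * L * (1 - w) <= A * L * expR (- w).
    by apply: ler_wpM2l h3; apply: mulr_ge0; exact: ltW.
  have h5 : A * L * expR (- w) <= expR w * expR (- w).
    by rewrite ler_wpM2r ?expR_ge0.
  by apply: le_trans h4 (le_trans h5 _); rewrite -expRD subrr expR0.
have wL : w * L <= 883 / 1000.
  have N1 : 0 < p.-1%:R - 1 :> R by move: xN; clear -hc; lra.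
  have -> : w * L = 881 / 1000 + L / (p.-1%:R - 1).
    by rewrite /w; field; rewrite !gt_eqF.
  have : L / (p.-1%:R - 1) <= 2 / 1000 by rewrite ler_pdivrMr.
  by clear; lra.
have Al : A * l - 1 <= 884 / 1000 * A.
  have h1 : A * l <= A * (L + 1 / (100 * 100)) by rewrite ler_wpM2l ?(ltW A0)//; lra.
  have h2 : A * (w * L) <= A * (883 / 1000) by rewrite ler_wpM2l ?(ltW A0).
  by move: h1 h2 AL A0; clear; lra.
have l0 : 0 < l by exact: lt_le_trans Ll.
have main : A - l^-1 <= 985 / 1000 * A ^+ 2.
  rewrite -(ler_pM2r l0) mulrBl mulVf ?gt_eqF//.
  apply: le_trans Al _.
  have h1 : A * (1123 / 1251) <= A * (A * l).
    rewrite ler_wpM2l ?(ltW A0)//; apply: le_trans hi _.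
    by rewrite ler_wpM2l ?(ltW A0).
  by move: h1 A0; clear; nra.
have -> : A / p%:R - (p%:R * l)^-1 = (A - l^-1) / p%:R by rewrite invfM mulrBl [p%:R^-1 * _]mulrC.
have -> : 985 / 1000 * (C ^+ 2 * (M p ^+ 2 / p%:R)) = 985 / 1000 * A ^+ 2 / p%:R.
  by rewrite /A; ring.
by rewrite ler_wpM2r ?invr_ge0 ?(ltW p0).
Qed.

Lemma surplus_sum_le (X : nat) :
  \sum_(0 <= p < X | prime p && (3 < p)%N) surplus C p <= 59 / 10000.
Proof.
have C0 := expR_gt0 c.
pose n := (100 ^ 2)%N; pose B := 985 / 1000 * (C ^+ 2).
have B0 : 0 <= B.
  have k0 : 0 <= 985 / 1000 :> R by lra.
  by apply: (mulr_ge0 k0); rewrite exprn_ge0 ?(ltW C0).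
have step1 : \sum_(0 <= p < X | prime p && (3 < p)%N) surplus C p <=
    \sum_(0 <= p < n.+1 + X | prime p && (n < p)%N) B * (M p ^+ 2 / p%:R).
  rewrite (@big_nat_widen _ _ _ 0%N X (n.+1 + X))//; last by rewrite leq_addl.
  rewrite [leLHS]big_mkcond [leRHS]big_mkcond; apply: ler_sum => p _.
  have [pp|] //= := boolP (prime p).
  have Bp : 0 <= B * (M p ^+ 2 / p%:R).
    by rewrite mulr_ge0// divr_ge0// exprn_ge0// ltW// mertens_product_gt0.
  case: ifP => [/andP[p3 _]|_]; last by case: ifP.
  case: ltnP => pn.
    apply: le_trans (surplus_large pp pn) _.
    by rewrite /B le_eqVlt; apply/orP; left; apply/eqP; ring.
  by rewrite surplus_small// pn andbT ltnW.
apply: le_trans step1 _.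
rewrite -big_distrr/=.
have step2 : \sum_(0 <= p < n.+1 + X | prime p && (n < p)%N) M p ^+ 2 / p%:R <=
    M n.+1 ^+ 2 / (2 - n%:R^-1).
  have h := @mertens_sq_telescope R n X isT.
  rewrite [leLHS](_ : _ = \sum_(n.+1 <= p < n.+1 + X | prime p) M p ^+ 2 / p%:R).
    apply: le_trans h _; rewrite ler_wpM2r//; last first.
      by rewrite gerBl exprn_ge0// ltW// mertens_product_gt0.
    rewrite invr_ge0 subr_ge0; apply: (@le_trans _ _ 1); last by lra.
    by rewrite invf_le1 ?ltr0n// ler1n.
  by rewrite [RHS](big_nat_widenl _ 0%N).
apply: le_trans (ler_wpM2l B0 step2) _.
have [_ hM] := bracket_result R; rewrite -/n in hM.
have l1 := @ln_ge_10000 R n (leqnn _).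
have hn : n%:R = 100 * 100 :> R by rewrite /n natrX expr2.
have M0 := mertens_product_gt0 R n.+1.
have hx : M n.+1 <= 1123 / (40 * 50) / (921 / 100).
  rewrite ler_pdivlMr; last by lra.
  apply: le_trans hM; rewrite ler_wpM2l// ltW//.
have hC := const_le.
have hCM : C * M n.+1 <= 61 * 73 / (50 * 50) * (1123 / (40 * 50) / (921 / 100)).
  by apply: ler_pM; rewrite ?(ltW C0) ?(ltW M0).
have CM0 : 0 <= C * M n.+1 by rewrite mulr_ge0 ?(ltW C0) ?(ltW M0).
have hCM2 : C * M n.+1 <= 1086 / 10000 by apply: le_trans hCM _; lra.
have sq : (C * M n.+1) ^+ 2 <= (1086 / 10000) ^+ 2.
  by rewrite !expr2; exact: (ler_pM CM0 CM0 hCM2 hCM2).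
have -> : B * (M n.+1 ^+ 2 / (2 - n%:R^-1)) =
   (C * M n.+1) ^+ 2 * (985 / 1000 / (2 - n%:R^-1)) by rewrite /B; ring.
have hd : 985 / 1000 / (2 - n%:R^-1) <= 4926 / 10000 :> R.
  by rewrite hn; clear -hc; rewrite ler_pdivrMr; lra.
have y0 : 0 <= (C * M n.+1) ^+ 2 by rewrite exprn_ge0.
apply: le_trans (ler_wpM2l y0 hd) _.
by move: sq; move: ((C * M n.+1) ^+ 2) => y; clear; lra.
Qed.

End surplus_bound.

(** * Sums over primitive sets of odd integers *)

Definition partial_mertens (R : realType) (T : pred nat) (q : nat) : R :=
  \prod_(0 <= r < q | prime r && T r) (1 - r%:R^-1).

Lemma partial_mertens_geq (R : realType) (p q : nat) : (p <= q)%N ->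
  mertens_product R q =
  mertens_product R p * partial_mertens R (fun r => (p <= r)%N) q.
Proof.
move=> pq; rewrite /mertens_product /partial_mertens.
rewrite (@big_cat_nat _ _ _ p)//=; congr (_ * _).
by rewrite (big_nat_widenl _ 0%N).
Qed.

Lemma partial_mertens_neq (R : realType) (p q : nat) : prime p -> (p < q)%N ->
  mertens_product R q =
  (1 - p%:R^-1) * partial_mertens R (fun r => r != p) q.
Proof.
move=> pp pq; rewrite /mertens_product /partial_mertens !big_mkord.
by rewrite (bigD1 (Ordinal pq))//=.
Qed.

Section primitive_sums.
Context {R : realType}.

Lemma primitive_sum_le (S : set nat) (T : pred nat) (d : nat) (K : R) :
  primitive_set S -> (0 < d)%N -> 0 <= K ->
  (forall a, S a -> [/\ (d %| a)%N, smooth_set T a &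
    (ln a%:R)^-1 <= K * partial_mertens R T (max_pdiv a)]) ->
  (erdos_sum R S <= (K / d%:R)%:E)%E.
Proof.
move=> [S1 Sp] d0 K0 hS; apply: esum_nat_le => B uB BS.
have h := @primitive_density R T d B d0 uB (fun a aB => S1 _ (BS _ aB))
  (fun a b aB bB => Sp a b (BS _ aB) (BS _ bB)) _ _.
apply: le_trans (ler_wpM2l K0 (h _ _)); last 2 first.
- by move=> a /BS/hS[].
- by move=> a /BS/hS[].
rewrite mulr_sumr big_seq [leRHS]big_seq; apply: ler_sum => a /BS/hS[_ _ ha].
by rewrite invfM mulrCA ler_wpM2l ?invr_ge0.
Qed.

Variable c : R.
Hypothesis hc : mertens_const c.
Local Notation M := (mertens_product R).
Local Notation C := (expR c).

Lemma pdiv_max_le (a : nat) : (1 < a)%N -> (pdiv a <= max_pdiv a)%N.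
Proof.
by move=> a1; apply: pdiv_min_dvd; rewrite ?prime_gt1 ?max_pdiv_prime// max_pdiv_dvd.
Qed.

Lemma odd_composite_ln (a : nat) : (1 < a)%N -> odd a -> ~~ prime a ->
  (ln a%:R)^-1 <= C * M (max_pdiv a).
Proof.
move=> a1 ao ap; have qp := max_pdiv_prime a1; have qa := max_pdiv_dvd a.
set q := max_pdiv a in qp qa *.
have q0 := prime_gt0 qp.
have qo : odd q := dvdn_odd qa ao.
have q2 : (2 < q)%N by case: q qp qo {qa q0} => [|[|[|]]].
have a3 : (3 * q <= a)%N.
  move: qa => /dvdnP[k ek]; rewrite ek leq_mul2r; apply/orP; right.
  case: k ek => [|[|[|k]]] // ek.
  - by move: a1; rewrite ek.
  - by move: ap; rewrite ek mul1n qp.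
  - by move: ao; rewrite ek oddM.
have l0 : 0 < ln a%:R :> R by rewrite ln_gt0// ltr1n.
have h := strong_mertens hc qp q2.
rewrite -div1r ler_pdivrMr//; apply: le_trans h _.
rewrite ler_wpM2l ?mulr_ge0 ?expR_ge0 ?(ltW (mertens_product_gt0 _ _))//.
rewrite -lnM ?posrE ?ltr0n// ler_ln ?posrE ?mulr_gt0 ?ltr0n ?(ltnW a1)//.
by rewrite -natrM ler_nat.
Qed.

Lemma primitive_subset (A B : set nat) : B `<=` A -> primitive_set A -> primitive_set B.
Proof. by move=> BA [A1 Ap]; split => [a /BA/A1//|a b /BA Aa /BA Ab]; exact: Ap. Qed.

Definition with_pdiv (A : set nat) (p : nat) : set nat := A `&` [set a | pdiv a = p].

Lemma with_pdiv_composite (A : set nat) (p : nat) : primitive_set A ->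
  (forall a, A a -> odd a) -> prime p -> ~ A p ->
  (erdos_sum R (with_pdiv A p) <= (C * M p / p%:R)%:E)%E.
Proof.
move=> pA Ao pp nAp; apply: (@primitive_sum_le _ (fun r => (p <= r)%N)).
- by apply: primitive_subset pA; exact: subIsetl.
- exact: prime_gt0.
- by rewrite mulr_ge0 ?expR_ge0 ?(ltW (mertens_product_gt0 _ _)).
move=> a [Aa /= pa]; have a1 : (1 < a)%N by case: pA => + _; apply.
split; first by rewrite -pa pdiv_dvd.
  split; first exact: ltnW.
  by move=> r pr ra; rewrite -pa; apply: pdiv_min_dvd => //; exact: prime_gt1.
rewrite -mulrA -partial_mertens_geq; last by rewrite -pa pdiv_max_le.
apply: odd_composite_ln => //; first exact: Ao.
apply/negP => ap; apply: nAp; rewrite -pa.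
by rewrite (pdiv_id ap).
Qed.

Lemma erdos_term_ge0 a : 0 <= (a%:R * ln a%:R)^-1 :> R.
Proof.
rewrite invr_ge0 mulr_ge0//; case: a => [|a]; first by rewrite ln0.
by rewrite ln_ge0// ler1n.
Qed.

Lemma with_pdiv_le (A : set nat) (p : nat) : primitive_set A ->
  (forall a, A a -> odd a) -> prime p ->
  (erdos_sum R (with_pdiv A p) <= ((p%:R * ln p%:R)^-1 + surplus C p)%:E)%E.
Proof.
move=> pA Ao pp; have [Ap|nAp] := pselect (A p); last first.
  apply: le_trans (with_pdiv_composite pA Ao pp nAp) _.
  by rewrite lee_fin -lerBlDl /surplus le_max lexx orbT.
have -> : with_pdiv A p = [set p].
  apply/seteqP; split=> [a [Aa /= pa]|a /= ->]; last by split=> //=; exact: pdiv_id.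
  by case: pA => _ /(_ p a Ap Aa); rewrite -pa pdiv_dvd => /(_ isT).
rewrite /erdos_sum esum_set1 ?lee_fin ?erdos_term_ge0//.
by rewrite lerDl surplus_ge0.
Qed.

Lemma erdos_sum_with_pdiv (A : set nat) : primitive_set A ->
  erdos_sum R A = \esum_(p in prime_support A) erdos_sum R (with_pdiv A p).
Proof.
move=> [A1 Ap]; have eA : A = \bigcup_(p in prime_support A) with_pdiv A p.
  apply/seteqP; split=> [a Aa|a [p _ []]//]; exists (pdiv a) => //.
  by split; [apply/pdiv_prime/A1 | exists a => //; exact: pdiv_dvd].
rewrite {1}eA /erdos_sum esum_bigcup//.
  move=> p q _ _ [a [[_ /= pa] [_ /= qa]]]; by rewrite -pa -qa.
by move=> a _; rewrite lee_fin erdos_term_ge0.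
Qed.

Lemma odd_erdos_sum_le (A : set nat) : primitive_set A ->
  (forall a, A a -> odd a) ->
  (erdos_sum R A <= erdos_sum R (prime_support A)
     + \esum_(p in prime_support A) (surplus C p)%:E)%E.
Proof.
move=> pA Ao; rewrite erdos_sum_with_pdiv//.
rewrite -esumD; [|by move=> p _; rewrite lee_fin ?erdos_term_ge0 ?surplus_ge0..].
by apply: le_esum => p [pp _]; exact: with_pdiv_le.
Qed.

Lemma esum_surplus_le (Q : set nat) : (forall p, Q p -> prime p /\ odd p) ->
  (\esum_(p in Q) (surplus C p)%:E <= epsilon0 R)%E.
Proof.
move=> hQ; rewrite /epsilon0 esum_mkcond [leRHS]esum_mkcond; apply: le_esum => p _.
have cg : C <= expR (euler_gamma R) by rewrite ler_expR; exact: mertens_const_le_gamma.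
have M0 := ltW (mertens_product_gt0 R p).
have i0 : 0 <= p%:R^-1 :> R by rewrite invr_ge0.
have tE (x : R) : x / p%:R * M p - (p%:R * ln p%:R)^-1 = p%:R^-1 * (x * M p - (ln p%:R)^-1).
  by rewrite invfM; ring.
case: (pselect (Q p)) => Qp; last first.
  rewrite memNset//; case: ifP => // /set_mem [pp _ nm].
  rewrite lee_fin tE mulr_ge0// subr_ge0 leNgt; apply/negP => h; apply: nm.
  by split=> //; exact: ltW.
have [pp po] := hQ _ Qp; rewrite mem_set// /surplus [C * _ / _]mulrAC !tE.
have le1 : p%:R^-1 * (C * M p - (ln p%:R)^-1) <=
    p%:R^-1 * (expR (euler_gamma R) * M p - (ln p%:R)^-1).
  by rewrite ler_wpM2l// lerD2r ler_wpM2r.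
have [mp|mp] := pselect (mertens_prime R p).
  rewrite memNset; last by case.
  rewrite lee_fin ge_max lexx/=. apply: le_trans le1 _.
  by rewrite mulr_ge0_le0// subr_le0; case: mp.
rewrite mem_set; last by [].
rewrite lee_fin ge_max le1 andbT mulr_ge0// subr_ge0 leNgt; apply/negP => h.
by apply: mp; split=> //; exact: ltW.
Qed.

Lemma esum_surplus_ge5 (Q : set nat) : (forall p, Q p -> prime p /\ (3 < p)%N) ->
  (\esum_(p in Q) (surplus C p)%:E <= (59 / 10000)%:E)%E.
Proof.
move=> hQ; apply: esum_nat_le => r ur rQ; pose X := (\max_(n <- r) n).+1.
apply: (le_trans _ (surplus_sum_le hc X)); rewrite -[leRHS]big_filter.
apply: ler_sum_subseq => //; [exact: surplus_ge0|by rewrite filter_uniq ?iota_uniq|].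
move=> p pr; have [pp p3] := hQ _ (rQ _ pr).
by rewrite mem_filter pp p3 mem_index_iota ltnS leq_bigmax_seq.
Qed.

End primitive_sums.

(** * Sums over primitive sets of even integers *)

Section even_part.
Context {R : realType}.
Variable c : R.
Hypothesis hc : mertens_const c.
Local Notation M := (mertens_product R).
Local Notation C := (expR c).

Lemma even_composite_ln (a : nat) : (1 < a)%N -> ~~ odd a -> a != 2%N ->
  (ln a%:R)^-1 <= C * (25 / 22) * M (max_pdiv a) /\
  ((2 < max_pdiv a)%N \/ (ln a%:R)^-1 <= C * (25 / 33)).
Proof.
move=> a1 ae a2; have qp := max_pdiv_prime a1; have qa := max_pdiv_dvd a.
set q := max_pdiv a in qp qa *.
have l0 : 0 < ln a%:R :> R by rewrite ln_gt0// ltr1n.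
have [/andP[b1 b2] /andP[d1 d2] /andP[f1 f2]] := ln235_bounds R.
have hC := const_ge hc; have C0 := expR_gt0 c.
have M0 := mertens_product_gt0 R q.
have a4 : (4 <= a)%N by move: a1 ae a2; case: a {qp qa q l0 M0} => [|[|[|[|]]]].
have l4 : ln 2 + ln 2 <= ln a%:R :> R.
  rewrite -lnM ?posrE// ler_ln ?posrE ?mulr_gt0 ?ltr0n ?(ltnW a1)//.
  by rewrite -natrM ler_nat.
have bound (m : R) : 0 < m -> 22 / 25 <= C * m * ln a%:R ->
    (ln a%:R)^-1 <= C * (25 / 22) * m.
  move=> m0 h; rewrite -div1r ler_pdivrMr//.
  by move: h; move: (ln a%:R) => l; move: C => C'; clear; lra.
have [q2|q2] := leqP q 2.
  have eq2 : q = 2%N by apply/eqP; rewrite eqn_leq q2 prime_gt1.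
  have M2 : M q = 1.
    rewrite eq2 !mertens_productS /mertens_product big_geq//.
    by rewrite (_ : prime 1 = false)// (_ : prime 0 = false)// !mulr1.
  have Cl : C * (ln 2 + ln 2) <= C * ln a%:R by rewrite ler_wpM2l// ltW.
  have Cl2 : 2000 / 1251 * (1386 / 1000) <= C * (ln 2 + ln 2).
    have c1 : 0 <= 2000 / 1251 :> R by clear -hc; lra.
    have c2 : 0 <= 1386 / 1000 :> R by clear -hc; lra.
    by apply: ler_pM => //; move: b1 hC; clear -hc; lra.
  split.
    apply: bound; first by rewrite M2.
    by rewrite M2 mulr1; move: (le_trans Cl2 Cl); clear -hc; lra.
  right; rewrite -div1r ler_pdivrMr//.
  by move: Cl Cl2; move: (ln a%:R) (ln 2) => l m; move: C => C'; clear; lra.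
split; last by left.
apply: bound => //.
have qo : odd q by case: (even_prime qp) => // e; move: q2; rewrite e.
have a2q : (2 * q <= a)%N.
  move: qa => /dvdnP[k ek]; rewrite ek leq_mul2r; apply/orP; right.
  case: k ek => [|[|k]] // ek; first by move: a1; rewrite ek.
  by move: ae; rewrite ek mul1n qo.
have q0 : 0 < q%:R :> R by rewrite ltr0n prime_gt0.
have la : ln 2 + ln q%:R <= ln a%:R :> R.
  rewrite -lnM ?posrE// ler_ln ?posrE ?mulr_gt0 ?ltr0n ?(ltnW a1) ?(prime_gt0 qp)//.
  by rewrite -natrM ler_nat.
have CM0 : 0 < C * M q by rewrite mulr_gt0.
suff : (22 / 25 : R) <= C * M q * (ln 2 + ln q%:R).
  by move=> h; apply: (le_trans h); rewrite ler_wpM2l// ltW.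
have [q11|q11] := leqP 11 q.
  have h := strong_mertens hc qp q2.
  have l10 : ln 2 + ln 5 <= ln q%:R :> R.
    rewrite -lnM ?posrE// ler_ln ?posrE ?mulr_gt0//.
    by rewrite -natrM ler_nat (leq_trans _ q11).
  have h2 : 22 / 25 * (ln 3 + ln q%:R) <= ln 2 + ln q%:R :> R.
    by move: b1 d2 f1 l10; clear; lra.
  have := ler_wpM2l (ltW CM0) h2.
  move: h; move: (ln 3 + _ : R) (ln 2 + _ : R) (C * M q) => x y z; clear; lra.
have [M3 M5 M7 _] := mertens_product_10 R.
have : q \in [:: 3; 5; 7]%N.
  by move: qp q2 q11; clear; case: q => [|[|[|[|[|[|[|[|[|[|[|q]]]]]]]]]]].
have C1 : 159 / 100 <= C by move: hC; clear; lra.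
have fin (m l : R) : 0 <= m -> 0 <= l -> 22 / 25 <= 159 / 100 * (m * l) -> 22 / 25 <= C * m * l.
  move=> m0 l00 h; rewrite -[C * m * l]mulrA; apply: (le_trans h).
  by apply: ler_wpM2r => //; exact: mulr_ge0.
rewrite !inE => /or3P[]/eqP ->.
- rewrite M3; apply: fin; [by clear -hc; lra|by move: b1 d1; clear -hc; lra..].
- rewrite M5; apply: fin; [by clear -hc; lra|by move: b1 f1; clear -hc; lra..].
have l7 : ln 2 + ln 3 <= ln 7%:R :> R.
  by rewrite -lnM ?posrE// ler_ln ?posrE ?mulr_gt0// -natrM ler_nat.
rewrite M7; apply: fin; [by clear -hc; lra|by move: b1 d1 l7; clear -hc; lra..].
Qed.

Lemma smooth_setT (a : nat) : (0 < a)%N -> smooth_set predT a.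
Proof. by []. Qed.

Lemma even_sum_le (E : set nat) : primitive_set E -> (forall a, E a -> ~~ odd a) ->
  ~ E 2%N -> (erdos_sum R E <= (C * (25 / 22) / 2)%:E)%E.
Proof.
move=> pE Ee nE2; apply: (@primitive_sum_le _ _ predT) => //.
move=> a Ea; have a1 : (1 < a)%N by case: pE => + _; apply.
have a2 : a != 2%N by apply/eqP => e; apply: nE2; rewrite -e.
split; [by rewrite dvdn2 Ee|exact/smooth_setT/ltnW|].
have [h _] := even_composite_ln a1 (Ee _ Ea) a2.
apply: le_trans h _; rewrite le_eqVlt; apply/orP; left; apply/eqP; congr (_ * _).
by apply: eq_bigl => p; rewrite andbT.
Qed.

Lemma even_sum_3free_le (E : set nat) : primitive_set E ->
  (forall a, E a -> ~~ odd a) -> ~ E 2%N -> (forall a, E a -> ~~ (3 %| a)%N) ->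
  (erdos_sum R E <= (C * (25 / 33) / 2)%:E)%E.
Proof.
move=> pE Ee nE2 E3; apply: (@primitive_sum_le _ _ (fun r => r != 3%N)) => //.
move=> a Ea; have a1 : (1 < a)%N by case: pE => + _; apply.
have a2 : a != 2%N by apply/eqP => e; apply: nE2; rewrite -e.
split; first by rewrite dvdn2 Ee.
  split; first exact: ltnW.
  by move=> r pr ra; apply: contraNneq (E3 _ Ea) => <-.
have [h1 h2] := even_composite_ln a1 (Ee _ Ea) a2.
have C0 := expR_gt0 c.
have [q3|q3] := ltnP 3 (max_pdiv a).
  apply: le_trans h1 _; rewrite (@partial_mertens_neq R 3)//.
  move: (partial_mertens _ _ _) C0 => m; move: C => C' C0.
  by rewrite le_eqVlt; apply/orP; left; apply/eqP; field.
have q2 : (max_pdiv a <= 2)%N.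
  rewrite -ltnS ltn_neqAle q3 andbT; apply/negP => /eqP e.
  by have := E3 _ Ea; rewrite -e max_pdiv_dvd.
case: h2 => [|h2]; first by rewrite ltnNge q2.
apply: le_trans h2 _; rewrite [X in _ <= _ * X](_ : _ = 1) ?mulr1//.
rewrite /partial_mertens big_nat_cond big1// => r /andP[/andP[_ rq] /andP[pr _]].
by have := leq_trans rq q2; rewrite ltnNge prime_gt1.
Qed.

Lemma primes_primitive (Q : set nat) : (forall p, Q p -> prime p) -> primitive_set Q.
Proof.
move=> Qp; split=> [a /Qp/prime_gt1//|a b /Qp pa /Qp pb].
by rewrite dvdn_prime2// => /eqP.
Qed.

Lemma erdos_sum_primes_fin (Q : set nat) : (forall p, Q p -> prime p /\ (2 < p)%N) ->
  (erdos_sum R Q < +oo)%E.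
Proof.
move=> hQ; apply: (@le_lt_trans _ _ (2 * C / 1%:R)%:E); last exact: ltry.
have C0 := expR_gt0 c.
apply: (@primitive_sum_le _ _ predT) => //.
  by apply: primes_primitive => p /hQ[].
move=> p /hQ[pp p2]; split; [exact: dvd1n|exact/smooth_setT/prime_gt0|].
have -> : max_pdiv p = p.
  apply/eqP; rewrite -dvdn_prime2 ?max_pdiv_prime ?prime_gt1//; exact: max_pdiv_dvd.
have -> : partial_mertens R predT p = M p.
  by apply: eq_bigl => r; rewrite andbT.
have p0 : 0 < p%:R :> R by rewrite ltr0n prime_gt0.
have l3 : ln 3 <= ln p%:R :> R by rewrite ler_ln ?posrE// ler_nat.
have [_ /andP[b1 _] _] := ln235_bounds R.
have l0 : 0 < ln p%:R :> R by lra.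
have h := strong_mertens hc pp p2; rewrite -div1r ler_pdivrMr//.
apply: le_trans h _; have CM0 : 0 <= C * M p.
  by rewrite mulr_ge0 ?(ltW C0) ?(ltW (mertens_product_gt0 _ _)).
have : C * M p * (ln 3 + ln p%:R) <= C * M p * (2 * ln p%:R) by rewrite ler_wpM2l//; lra.
move: (C * M p * (ln 3 + _)) => x; rewrite mulrCA !mulrA.
by rewrite [2 * C]mulrC.
Qed.

End even_part.

Local Open Scope ereal_scope.

Lemma erdos_sum_support_ge (R : realType) (A B : set nat) (r : seq nat) :
  A `<=` B -> uniq r -> (forall n, n \in r -> B n /\ ~ A n) ->
  (\sum_(n <- r) (n%:R * ln n%:R)^-1)%:E + erdos_sum R A <= erdos_sum R B.
Proof.
move=> AB ur hr; rewrite /erdos_sum (esumID A B); last first.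
  by move=> n _; rewrite lee_fin erdos_term_ge0.
rewrite (setIidr AB) [leRHS]addeC leeD2r//.
by apply: (@le_esum_nat R _ (fun n => (n%:R * ln n%:R)^-1)%R) => // n /hr[].
Qed.

Theorem theorem4p5 (R : realType) (A : set nat) (hA : primitive_set A)
  (hf : erdos_sum R (prime_support A) + epsilon0 R < erdos_sum R A) :
  erdos_sum R (odd_part A) < erdos_sum R (prime_support (odd_part A)).
Proof.
have [c hc] := mertens_const_exists R.
set O := odd_part A; pose E := A `&` [set a | ~~ odd a].
have pO : primitive_set O by apply: primitive_subset hA; exact: subIsetl.
have pE : primitive_set E by apply: primitive_subset hA; exact: subIsetl.
have Oo a : O a -> odd a by case.
have Ee a : E a -> ~~ odd a by case.
have PO p : prime_support O p -> prime p /\ (2 < p)%N.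
  move=> [pp [a [_ ao] pa]]; split=> //; rewrite ltn_neqAle prime_gt1// andbT.
  by apply/eqP => e; move: pa; rewrite -e dvdn2 ao.
have subP : prime_support O `<=` prime_support A.
  by move=> p [pp [a [Aa _] pa]]; split=> //; exists a.
have hC := const_le hc; have C0 := expR_gt0 c.
have [/andP[b1 b2] /andP[d1 d2] _] := ln235_bounds R.
have f2 : (721 / 1000 <= (2%:R * ln 2%:R)^-1 :> R)%R.
  rewrite -[leRHS]div1r ler_pdivlMr; last by rewrite mulr_gt0//; lra.
  by lra.
have f3 : (3034 / 10000 <= (3%:R * ln 3%:R)^-1 :> R)%R.
  rewrite -[leRHS]div1r ler_pdivlMr; last by rewrite mulr_gt0//; lra.
  by lra.
have [[n3 P3]|cases] := pselect (~ A 3%N /\ prime_support O 3%N).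
  rewrite (erdos_sum_with_pdiv pO).
  rewrite (esumID [set 3%N]); last first.
    by move=> p _; apply: esum_ge0 => a _; rewrite lee_fin erdos_term_ge0.
  rewrite [X in _ < X](esumID [set 3%N]); last by move=> p _; rewrite lee_fin erdos_term_ge0.
  have -> : prime_support O `&` [set 3%N] = [set 3%N] by apply/setIidr => _ ->.
  set Q := _ `&` ~` _.
  rewrite !esum_set1; last 2 first.
  - by rewrite lee_fin erdos_term_ge0.
  - by apply: esum_ge0 => a _; rewrite lee_fin erdos_term_ge0.
  have hQ p : Q p -> prime p /\ (3 < p)%N.
    move=> [/PO[pp p2] /= p3]; split=> //; rewrite ltn_neqAle p2 andbT.
    by apply/eqP => e; apply: p3.
  have nO3 : ~ O 3%N by case.
  have h3 := with_pdiv_composite hc pO Oo (isT : prime 3) nO3.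
  have [M3 _ _ _] := mertens_product_10 R; rewrite M3 in h3.
  have hR : \esum_(p in Q) erdos_sum R (with_pdiv O p) <=
      erdos_sum R Q + (59 / 10000)%:E.
    apply: (@le_trans _ _ (\esum_(p in Q) ((p%:R * ln p%:R)^-1%:E + (surplus (expR c) p)%:E))).
      by apply: le_esum => p /hQ[pp _]; exact: with_pdiv_le.
    rewrite esumD; [|by move=> p _; rewrite lee_fin ?erdos_term_ge0 ?surplus_ge0..].
    by rewrite leeD2l// esum_surplus_ge5.
  apply: le_lt_trans (leeD h3 hR) _.
  have fin : erdos_sum R Q \is a fin_num.
    rewrite ge0_fin_numE; last by apply: esum_ge0 => a _; rewrite lee_fin erdos_term_ge0.
    by apply: (erdos_sum_primes_fin hc) => p /hQ[pp /ltnW].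
  rewrite addeA [_ + erdos_sum R Q]addeC -addeA [X in _ < X]addeC.
  rewrite lteD2lE// -EFinD lte_fin.
  apply: lt_le_trans f3; move: hC; move: (expR c) => C; clear; lra.
exfalso; move: hf; apply/negP; rewrite -leNgt.
have fA : erdos_sum R A = erdos_sum R E + erdos_sum R O.
  rewrite /erdos_sum (esumID [set a | odd a]) 1?addeC//.
    by rewrite (_ : A `&` ~` _ = E)//; apply/seteqP; split=> a [Aa /negP].
  by move=> a _; rewrite lee_fin erdos_term_ge0.
have hO : erdos_sum R O <= erdos_sum R (prime_support O) + epsilon0 R.
  apply: le_trans (odd_erdos_sum_le hc pO Oo) _; rewrite leeD2l//.
  apply: (esum_surplus_le hc) => p [pp [a [_ ao] pa]]; split=> //.
  exact: dvdn_odd ao.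
suff key : erdos_sum R E + erdos_sum R (prime_support O) <= erdos_sum R (prime_support A).
  by rewrite fA; apply: le_trans (leeD2l _ hO) _; rewrite addeA leeD2r.
have [E0|/set0P[e Ee0]] := eqVneq E set0.
  rewrite E0 /erdos_sum esum_set0 add0e.
  have := @erdos_sum_support_ge R _ _ [::] subP isT.
  by rewrite big_nil add0e; apply => n; rewrite in_nil.
have nO2 : ~ prime_support O 2%N by move=> /PO[].
have P2 : prime_support A 2%N.
  by split=> //; exists e; [case: Ee0|rewrite dvdn2 Ee].
have [A2|nA2] := pselect (A 2%N).
  have -> : E = [set 2%N].
    apply/seteqP; split=> [a [Aa /= ae]|a ->]; last by split.
    by apply/esym; case: hA => _; apply => //; rewrite dvdn2.
  rewrite {1}/erdos_sum esum_set1 ?lee_fin ?erdos_term_ge0//.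
  have := @erdos_sum_support_ge R _ _ [:: 2%N] subP isT; rewrite big_seq1; apply.
  by move=> n; rewrite inE => /eqP ->.
have nE2 : ~ E 2%N by case.
have [E3|nE3] := pselect (forall a, E a -> ~~ (3 %| a)%N).
  apply: le_trans (leeD2r _ (even_sum_3free_le hc pE Ee nE2 E3)) _.
  have := @erdos_sum_support_ge R _ _ [:: 2%N] subP isT; rewrite big_seq1.
  move=> /(_ _)/(le_trans _); apply; last by move=> n; rewrite inE => /eqP ->.
  rewrite leeD2r// lee_fin; apply: le_trans f2.
  by move: hC; move: (expR c) => C; clear; lra.
have [a Ea a3] : exists2 a, E a & (3 %| a)%N.
  by move: nE3 => /existsNP[a /not_implyP[Ea /negP]]; rewrite negbK; exists a.
have PA3 : prime_support A 3%N by split=> //; exists a => //; case: Ea.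
have nA3 : ~ A 3%N.
  move=> A3; have [Aa ae] := Ea.
  by case: hA => _ /(_ _ _ A3 Aa a3) e3; move: ae; rewrite -e3.
have nO3 : ~ prime_support O 3%N by move=> P3; apply: cases.
apply: le_trans (leeD2r _ (even_sum_le hc pE Ee nE2)) _.
have := @erdos_sum_support_ge R _ _ [:: 2%N; 3%N] subP isT; rewrite !big_cons big_nil addr0.
move=> /(_ _)/(le_trans _); apply; last first.
  by move=> n; rewrite !inE => /orP[] /eqP ->.
rewrite leeD2r// lee_fin; apply: le_trans (lerD f2 f3).
by move: hC; move: (expR c) => C; clear; lra.
Qed.
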